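(* Let $(R,\mathfrak m)$ be a commutative Noetherian local ring with identity, let $R^{*}$ denote the $\mathfrak m$-adic completion of $R$, and let $M$ be a weakly Laskerian (unitary) $R$-module. Then $M\otimes_R R^{*}$ is a weakly Laskerian $R^{*}$-module.
   Context: For a commutative ring $A$, an $A$-module $M$ is called weakly Laskerian if the set of associated primes $\mathrm{Ass}_A(M/N)$ is finite for each proper $A$-submodule $N$ of $M$. *)

(* Defs.v *)
From HB Require Import structures.
From mathcomp Require Import all_boot all_algebra.
From mathcomp Require Import ring_quotient.
From mathcomp Require Import all_classical.
From mathcomp.multinomials Require Import freeg.

Set Implicit Arguments.
Unset Strict Implicit.
Unset Printing Implicit Defensive.

Import GRing.Theory.
Local Open Scope ring_scope.
Local Open Scope quotient_scope.
Local Open Scope classical_set_scope.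

(* Submodules are the library's [submodClosed V]: in the presence of the axioms
   of [boolp] every subset is a boolean predicate (see [asbool]), so this is no
   decidability restriction.  Likewise [idealr R] is the type of all proper
   ideals of a commutative ring R, and [submodClosed R^o] that of all ideals. *)

Section SubmoduleSpan.
Variables (R : pzRingType) (V : lmodType R).

Definition submod_span (A : set V) : {pred V} := fun v =>
  `[< forall N : submodClosed V, (forall a, A a -> a \in N) -> v \in N >].

Lemma submod_spanP (A : set V) v :
  reflect (forall N : submodClosed V, (forall a, A a -> a \in N) -> v \in N)
          (v \in submod_span A).
Proof. exact: asboolP. Qed.

Lemma mem_submod_span (A : set V) a : A a -> a \in submod_span A.
Proof. by move=> Aa; apply/submod_spanP => N; apply. Qed.

Fact submod_span_closed (A : set V) : subsemimod_closed (submod_span A).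
Proof.
split; first split.
- by apply/submod_spanP => N _; rewrite rpred0.
- move=> x y /submod_spanP Sx /submod_spanP Sy; apply/submod_spanP => N AN.
  by rewrite rpredD ?Sx ?Sy.
- move=> a x /submod_spanP Sx; apply/submod_spanP => N AN.
  by rewrite rpredZ ?Sx.
Qed.

HB.instance Definition _ (A : set V) :=
  GRing.isSubmodClosed.Build R V (submod_span A) (submod_span_closed A).

Definition finitely_generated (N : submodClosed V) :=
  exists s : seq V, N =i submod_span [set` s].

End SubmoduleSpan.

Section QuotientModule.
Variables (R : pzRingType) (V : lmodType R) (N : submodClosed V).

Definition submod_pred : {pred V} := N.

Fact submod_pred_closed : subsemimod_closed submod_pred.
Proof.
by split; [split; [exact: rpred0 | exact: rpredD] | exact: rpredZ].
Qed.

HB.instance Definition _ :=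
  GRing.isSubmodClosed.Build R V submod_pred submod_pred_closed.

Definition quotmod := {ideal_quot submod_pred}.

HB.instance Definition _ := GRing.Zmodule.on quotmod.
HB.instance Definition _ := EqQuotient.on quotmod.

Definition quotmod_pi (v : V) : quotmod := \pi_{ideal_quot submod_pred} v.

Lemma quotmod_piP u v : (quotmod_pi u = quotmod_pi v) <-> (u - v \in N).
Proof.
rewrite /quotmod_pi; split; last first.
  by move=> h; apply/eqP; rewrite -Quotient.idealrBE.
by move/eqP; rewrite -Quotient.idealrBE.
Qed.

Lemma quotmod_repr (x : quotmod) : quotmod_pi (repr x) = x.
Proof. exact: reprK. Qed.

Lemma quotmod_piD u v : quotmod_pi (u + v) = quotmod_pi u + quotmod_pi v.
Proof. exact: (raddfD \pi_{ideal_quot submod_pred}). Qed.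

Definition quotmod_scale (a : R) (x : quotmod) : quotmod :=
  quotmod_pi (a *: repr x).

Lemma quotmod_scaleE a v : quotmod_scale a (quotmod_pi v) = quotmod_pi (a *: v).
Proof.
by apply/quotmod_piP; rewrite -scalerBr rpredZ //; apply/quotmod_piP/quotmod_repr.
Qed.

Fact quotmod_scaleA a b x :
  quotmod_scale a (quotmod_scale b x) = quotmod_scale (a * b) x.
Proof. by rewrite -(quotmod_repr x) !quotmod_scaleE scalerA. Qed.

Fact quotmod_scale1 : left_id 1 quotmod_scale.
Proof. by move=> x; rewrite -(quotmod_repr x) quotmod_scaleE scale1r. Qed.

Fact quotmod_scaleDr : right_distributive quotmod_scale +%R.
Proof.
move=> a x y; rewrite -(quotmod_repr x) -(quotmod_repr y).
by rewrite -quotmod_piD !quotmod_scaleE scalerDr quotmod_piD.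
Qed.

Fact quotmod_scaleDl x : {morph quotmod_scale^~ x : a b / a + b}.
Proof.
move=> a b; rewrite -(quotmod_repr x).
by rewrite !quotmod_scaleE scalerDl quotmod_piD.
Qed.

HB.instance Definition _ := GRing.Zmodule_isLmodule.Build R quotmod
  quotmod_scaleA quotmod_scale1 quotmod_scaleDr quotmod_scaleDl.

Fact quotmod_pi_linear : linear quotmod_pi.
Proof. by move=> a u v; rewrite quotmod_piD -quotmod_scaleE. Qed.

HB.instance Definition _ :=
  GRing.isLinear.Build R V quotmod *:%R quotmod_pi quotmod_pi_linear.

End QuotientModule.

Section AssociatedPrimes.
Variables (A : comNzRingType) (M : lmodType A).

Definition prime_ideal (p : set A) :=
  idealr_closed [in p] /\ prime_idealr_closed [in p].

Definition ann (x : M) : set A := [set a | a *: x = 0].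

Definition Ass : set (set A) :=
  [set p | prime_ideal p /\ exists x : M, p = ann x].

End AssociatedPrimes.

Definition weakly_laskerian (A : comNzRingType) (M : lmodType A) :=
  forall N : submodClosed M, (exists x : M, x \notin N) ->
    finite_set (Ass (quotmod N)).

Definition noetherian (R : comNzRingType) :=
  forall I : submodClosed R^o, finitely_generated I.

Definition maximal_ideal (R : comNzRingType) (m : idealr R) :=
  forall J : idealr R, {subset m <= J} -> J =i m.

Definition local_ring (R : comNzRingType) (m : idealr R) :=
  maximal_ideal m /\ forall m' : idealr R, maximal_ideal m' -> m' =i m.

Section IdealPowers.
Variables (R : comNzRingType).

Definition ideal_mul (I J : {pred R}) : {pred R} :=
  submod_span (V := R^o) [set a * b | a in [set` I] & b in [set` J]].

Fixpoint ideal_exp (I : {pred R}) (n : nat) : {pred R} :=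
  if n is k.+1 then ideal_mul I (ideal_exp I k) else predT.

Variable (I : idealr R).

(* The powers I^1, I^2, I^3 and so on: the zeroth power is left out because the
   library's quotient rings are by proper ideals only. *)
Definition adic_ideal (n : nat) : {pred R} := ideal_exp I n.+1.


Definition idealr_pred : {pred R^o} := I.

Fact idealr_pred_closed : subsemimod_closed idealr_pred.
Proof.
split; first by split; [exact: rpred0 | exact: rpredD].
by move=> a x; apply: idealMr.
Qed.

HB.instance Definition _ :=
  GRing.isSubmodClosed.Build R R^o idealr_pred idealr_pred_closed.

Lemma adic_ideal_sub n : {subset adic_ideal n <= I}.
Proof.
move=> x /submod_spanP/(_ idealr_pred); apply => _ [a /= aI [b _] <-].
by rewrite mulrC; apply: idealMr.
Qed.

Fact adic_idealr_closed n : idealr_closed (adic_ideal n).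
Proof.
have h : subsemimod_closed (adic_ideal n : {pred R^o}) := submod_span_closed _.
split; first exact: h.1.1.
  by apply/negP => /adic_ideal_sub; rewrite idealr1.
by move=> a u v uI vI; apply: h.1.2 => //; apply: h.2.
Qed.

HB.instance Definition _ n :=
  isIdealr.Build R (adic_ideal n) (adic_idealr_closed n).

Lemma adic_idealS n : {subset adic_ideal n.+1 <= adic_ideal n}.
Proof.
have E k : forall a b, b \in ideal_exp I k -> a * b \in ideal_exp I k.
  case: k => [|k] a b hb //; exact: (submod_span_closed _).2.
have S k : {subset ideal_exp I k.+1 <= ideal_exp I k}.
  elim: k => [|k IHk] // x /submod_spanP h; apply/submod_spanP => N hN;
    apply: h => _ [a aI [b bI] <-].
  by apply: hN; exists a => //; exists b => //; apply: IHk.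
exact: S.
Qed.

End IdealPowers.

Section AdicCompletion.
Variables (R : comNzRingType) (I : idealr R).

Local Notation Q n := {ideal_quot (adic_ideal I n)}.

(* The transition map R/I^(n+2) -> R/I^(n+1). *)
Definition adic_trans n (x : Q n.+1) : Q n := \pi_(Q n) (repr x).

Lemma adic_transE n (a : R) : adic_trans (\pi_(Q n.+1) a) = \pi_(Q n) a.
Proof.
apply/eqP; rewrite -Quotient.idealrBE; apply: adic_idealS.
by rewrite Quotient.idealrBE reprK.
Qed.

Fact adic_trans_zmod_morphism n : zmod_morphism (@adic_trans n).
Proof.
move=> x y; rewrite -[x]reprK -[y]reprK.
by rewrite -rmorphB !adic_transE rmorphB.
Qed.

Fact adic_trans_monoid_morphism n : monoid_morphism (@adic_trans n).
Proof.
split=> [|x y]; first by rewrite -(rmorph1 \pi_(Q n.+1)) adic_transE rmorph1.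
rewrite -[x]reprK -[y]reprK.
by rewrite -rmorphM !adic_transE rmorphM.
Qed.

HB.instance Definition _ n := GRing.isZmodMorphism.Build (Q n.+1) (Q n)
  (@adic_trans n) (@adic_trans_zmod_morphism n).
HB.instance Definition _ n := GRing.isMonoidMorphism.Build (Q n.+1) (Q n)
  (@adic_trans n) (@adic_trans_monoid_morphism n).

(* The inverse limit of the rings R/I, R/I^2, R/I^3 and so on. *)
Record completion := Completion {
  adic_proj :> forall n, Q n;
  adic_projP : forall n, adic_trans (adic_proj n.+1) = adic_proj n
}.

Lemma completionP (x y : completion) : (forall n, x n = y n) -> x = y.
Proof.
case: x y => [x xP] [y yP] /= xy.
have {}xy : x = y by apply: functional_extensionality_dep.
by case: _ / xy in yP *; congr Completion; apply: Prop_irrelevance.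
Qed.

HB.instance Definition _ := gen_eqMixin completion.
HB.instance Definition _ := gen_choiceMixin completion.

Implicit Types x y z : completion.

Definition completion_zero : completion :=
  @Completion (fun=> 0) (fun=> rmorph0 _).
Definition completion_opp x : completion :=
  @Completion (fun n => - x n)
    (fun n => etrans (rmorphN _ _) (congr1 -%R (adic_projP x n))).
Definition completion_add x y : completion :=
  @Completion (fun n => x n + y n)
    (fun n => etrans (rmorphD _ _ _)
                (congr2 +%R (adic_projP x n) (adic_projP y n))).
Definition completion_one : completion :=
  @Completion (fun=> 1) (fun=> rmorph1 _).
Definition completion_mul x y : completion :=
  @Completion (fun n => x n * y n)
    (fun n => etrans (rmorphM _ _ _)
                (congr2 *%R (adic_projP x n) (adic_projP y n))).

Fact completion_addA : associative completion_add.
Proof. by move=> x y z; apply: completionP => n /=; rewrite addrA. Qed.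
Fact completion_addC : commutative completion_add.
Proof. by move=> x y; apply: completionP => n /=; rewrite addrC. Qed.
Fact completion_add0 : left_id completion_zero completion_add.
Proof. by move=> x; apply: completionP => n /=; rewrite add0r. Qed.
Fact completion_addN : left_inverse completion_zero completion_opp completion_add.
Proof. by move=> x; apply: completionP => n /=; rewrite addNr. Qed.

HB.instance Definition _ := GRing.isZmodule.Build completion
  completion_addA completion_addC completion_add0 completion_addN.

Fact completion_mulA : associative completion_mul.
Proof. by move=> x y z; apply: completionP => n /=; rewrite mulrA. Qed.
Fact completion_mulC : commutative completion_mul.
Proof. by move=> x y; apply: completionP => n /=; rewrite mulrC. Qed.
Fact completion_mul1 : left_id completion_one completion_mul.
Proof. by move=> x; apply: completionP => n /=; rewrite mul1r. Qed.
Fact completion_mulDl : left_distributive completion_mul +%R.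
Proof. by move=> x y z; apply: completionP => n /=; rewrite mulrDl. Qed.
Fact completion_oner_neq0 : completion_one != 0.
Proof.
apply/eqP => /(congr1 (fun x : completion => x 0%N))/eqP.
by rewrite (negPf (oner_neq0 (Q 0))).
Qed.

HB.instance Definition _ := GRing.Zmodule_isComNzRing.Build completion
  completion_mulA completion_mulC completion_mul1 completion_mulDl
  completion_oner_neq0.

Definition to_completion (a : R) : completion :=
  @Completion (fun n => \pi_(Q n) a) (fun n => adic_transE n a).

Fact to_completion_zmod_morphism : zmod_morphism to_completion.
Proof. by move=> a b; apply: completionP => n /=; rewrite rmorphB. Qed.
Fact to_completion_monoid_morphism : monoid_morphism to_completion.
Proof.
by split=> [|a b]; apply: completionP => n /=; rewrite (rmorph1, rmorphM).
Qed.

HB.instance Definition _ := GRing.isZmodMorphism.Build R completion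
  to_completion to_completion_zmod_morphism.
HB.instance Definition _ := GRing.isMonoidMorphism.Build R completion
  to_completion to_completion_monoid_morphism.

Definition completion_scale (a : R) x : completion := to_completion a * x.

Fact completion_scaleA a b x :
  completion_scale a (completion_scale b x) = completion_scale (a * b) x.
Proof. by rewrite /completion_scale mulrA rmorphM. Qed.
Fact completion_scale1 : left_id 1 completion_scale.
Proof. by move=> x; rewrite /completion_scale rmorph1 mul1r. Qed.
Fact completion_scaleDr : right_distributive completion_scale +%R.
Proof. by move=> a x y; rewrite /completion_scale mulrDr. Qed.
Fact completion_scaleDl x : {morph completion_scale^~ x : a b / a + b}.
Proof. by move=> a b; rewrite /completion_scale rmorphD mulrDl. Qed.

HB.instance Definition _ := GRing.Zmodule_isLmodule.Build R completion
  completion_scaleA completion_scale1 completion_scaleDr completion_scaleDl.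

Fact completion_scaleAl (a : R) x y : a *: (x * y) = (a *: x) * y.
Proof. exact: mulrA. Qed.
HB.instance Definition _ :=
  GRing.Lmodule_isLalgebra.Build R completion completion_scaleAl.
Fact completion_scaleAr (a : R) x y : a *: (x * y) = x * (a *: y).
Proof. exact: mulrCA. Qed.
HB.instance Definition _ :=
  GRing.Lalgebra_isAlgebra.Build R completion completion_scaleAr.

End AdicCompletion.

Section TensorProduct.
Variables (R : comNzRingType) (M N : lmodType R).

Local Notation F := {freeg (M * N)%type / R}.

Inductive tensor_rel : set F :=
| TensorDl x y z : tensor_rel (<< (x + y, z) >> - << (x, z) >> - << (y, z) >>)
| TensorDr x y z : tensor_rel (<< (x, y + z) >> - << (x, y) >> - << (x, z) >>)
| TensorZl a x y : tensor_rel (<< (a *: x, y) >> - a *: << (x, y) >>)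
| TensorZr a x y : tensor_rel (<< (x, a *: y) >> - a *: << (x, y) >>).

Definition tensor := quotmod (submod_span tensor_rel).
HB.instance Definition _ := GRing.Lmodule.on tensor.

Definition tens (x : M) (y : N) : tensor :=
  quotmod_pi (submod_span tensor_rel) << (x, y) >>.

Lemma tensDl x y z : tens (x + y) z = tens x z + tens y z.
Proof.
rewrite -quotmod_piD; apply/quotmod_piP; rewrite opprD addrA.
exact/mem_submod_span/TensorDl.
Qed.

Lemma tensDr x y z : tens x (y + z) = tens x y + tens x z.
Proof.
rewrite -quotmod_piD; apply/quotmod_piP; rewrite opprD addrA.
exact/mem_submod_span/TensorDr.
Qed.

Lemma tensZl a x y : tens (a *: x) y = a *: tens x y.
Proof. by rewrite -[RHS]linearZ; apply/quotmod_piP/mem_submod_span/TensorZl. Qed.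

Lemma tensZr a x y : tens x (a *: y) = a *: tens x y.
Proof. by rewrite -[RHS]linearZ; apply/quotmod_piP/mem_submod_span/TensorZr. Qed.

Lemma freegUZ (a b : R) (k : (M * N)%type) :
  a *: << b *g k >> = << a * b *g k >> :> F.
Proof. by apply/eqP/freeg_eqP => l; rewrite coeffZ !coeffU mulrA. Qed.

Lemma tensor_ind (P : tensor -> Prop) :
  P 0 -> (forall t u, P t -> P u -> P (t + u)) -> (forall x y, P (tens x y)) ->
  forall t, P t.
Proof.
move=> P0 PD Pt t; rewrite -(quotmod_repr t).
rewrite -[repr t]freeg_sumE.
elim: (dom _) => [|[x y] s IHs]; first by rewrite big_nil raddf0.
rewrite big_cons raddfD /=; apply: PD => //.
by rewrite -[coeff _ _]mulr1 -freegUZ linearZ /= -tensZl.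
Qed.

Section Lift.
Variables (P : lmodType R) (f : M -> N -> P).
Hypotheses (fDl : forall x y z, f (x + y) z = f x z + f y z)
           (fDr : forall x y z, f x (y + z) = f x y + f x z)
           (fZl : forall a x y, f (a *: x) y = a *: f x y)
           (fZr : forall a x y, f x (a *: y) = a *: f x y).

Definition tensor_lift (t : tensor) : P :=
  fglift (fun k : (M * N)%type => f k.1 k.2) (repr t).

Let fl (D : F) : P := fglift (fun k : (M * N)%type => f k.1 k.2) D.

Let flB D E : fl (D - E) = fl D - fl E.
Proof. exact: lift_is_additive. Qed.

Let fl0 : fl 0 = 0.
Proof. by rewrite -(subrr 0) flB subrr. Qed.

Let flD D E : fl (D + E) = fl D + fl E.
Proof. by rewrite -{1}[E]opprK flB -[- E]sub0r flB fl0 sub0r opprK. Qed.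

Let flZ a D : fl (a *: D) = a *: fl D.
Proof.
rewrite -[D]freeg_sumE; elim: (dom _) => [|k s IHs].
  by rewrite big_nil scaler0 fl0 scaler0.
by rewrite big_cons scalerDr !flD IHs freegUZ /fl !liftU scalerDr scalerA.
Qed.

Definition lift_ker : {pred F} := fun D => fl D == 0.

Let lift_ker_closed : subsemimod_closed lift_ker.
Proof.
split; first split; rewrite /lift_ker ?unfold_in.
- exact/eqP.
- by move=> D E; rewrite !unfold_in flD => /eqP-> /eqP->; rewrite addr0.
- by move=> a D; rewrite !unfold_in flZ => /eqP->; rewrite scaler0.
Qed.

HB.instance Definition _ :=
  GRing.isSubmodClosed.Build R F lift_ker lift_ker_closed.

Lemma tensor_lift_pi D : tensor_lift (quotmod_pi (submod_span tensor_rel) D) = fl D.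
Proof.
set t := quotmod_pi _ D; have := quotmod_repr t.
move/quotmod_piP/submod_spanP/(_ lift_ker) => h; apply/eqP.
rewrite -subr_eq0 -flB; apply: h => {t D} _ [x y z|x y z|a x y|a x y];
  rewrite unfold_in /lift_ker ?flB ?flZ /fl !liftU /= !scale1r subr_eq0.
- by rewrite fDl addrAC subrr add0r.
- by rewrite fDr addrAC subrr add0r.
- by rewrite fZl.
- by rewrite fZr.
Qed.

Lemma tensor_liftE x y : tensor_lift (tens x y) = f x y.
Proof. by rewrite tensor_lift_pi /fl liftU scale1r. Qed.

Lemma tensor_lift_linear : linear tensor_lift.
Proof.
move=> a t u; rewrite -(quotmod_repr t) -(quotmod_repr u) -linearP.
by rewrite !tensor_lift_pi flD flZ.
Qed.

End Lift.

End TensorProduct.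

Section ScalarExtension.
Variables (R : comNzRingType) (M : lmodType R) (S : comAlgType R).

(* M (x)_R S, as an S-module. *)
Definition scalar_ext := tensor M S.
HB.instance Definition _ := GRing.Zmodule.on scalar_ext.

Definition scalar_ext_scale (s : S) (t : scalar_ext) : scalar_ext :=
  tensor_lift (fun (x : M) (u : S) => tens x (s * u)) t.

Let bil (s : S) :
  [/\ forall (x y : M) (u : S), tens (x + y) (s * u) =
        tens x (s * u) + tens y (s * u),
      forall (x : M) (u v : S), tens x (s * (u + v)) =
        tens x (s * u) + tens x (s * v),
      forall (a : R) (x : M) (u : S), tens (a *: x) (s * u) = a *: tens x (s * u) &
      forall (a : R) (x : M) (u : S), tens x (s * (a *: u)) = a *: tens x (s * u)].
Proof.
split=> *; first exact: tensDl.
- by rewrite mulrDr tensDr.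
- exact: tensZl.
- by rewrite -scalerAr tensZr.
Qed.

Lemma scalar_ext_scaleE s x u : scalar_ext_scale s (tens x u) = tens x (s * u).
Proof. by have [Dl Dr Zl Zr] := bil s; rewrite /scalar_ext_scale tensor_liftE. Qed.

Fact scalar_ext_scaleDr : right_distributive scalar_ext_scale +%R.
Proof.
move=> s t u; have [Dl Dr Zl Zr] := bil s.
have := tensor_lift_linear Dl Dr Zl Zr 1 t u.
by rewrite !scale1r.
Qed.

Let scalar_ext_scale0 s : scalar_ext_scale s 0 = 0.
Proof.
by apply: (addrI (scalar_ext_scale s 0)); rewrite -scalar_ext_scaleDr !addr0.
Qed.

Fact scalar_ext_scaleA s s' t :
  scalar_ext_scale s (scalar_ext_scale s' t) = scalar_ext_scale (s * s') t.
Proof.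
elim/tensor_ind: t => [|t u IHt IHu|x u].
- by rewrite !scalar_ext_scale0.
- by rewrite !scalar_ext_scaleDr IHt IHu.
- by rewrite !scalar_ext_scaleE mulrA.
Qed.

Fact scalar_ext_scale1 : left_id 1 scalar_ext_scale.
Proof.
elim/tensor_ind => [|t u IHt IHu|x u].
- by rewrite !scalar_ext_scale0.
- by rewrite !scalar_ext_scaleDr IHt IHu.
- by rewrite !scalar_ext_scaleE mul1r.
Qed.

Fact scalar_ext_scaleDl t : {morph scalar_ext_scale^~ t : s s' / s + s'}.
Proof.
move=> s s'; elim/tensor_ind: t => [|t u IHt IHu|x u].
- by rewrite !scalar_ext_scale0 addr0.
- by rewrite !scalar_ext_scaleDr IHt IHu addrACA.
- by rewrite !scalar_ext_scaleE mulrDl tensDr.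
Qed.

HB.instance Definition _ := GRing.Zmodule_isLmodule.Build S scalar_ext
  scalar_ext_scaleA scalar_ext_scale1 scalar_ext_scaleDr scalar_ext_scaleDl.

End ScalarExtension.

(* Main.v *)
From HB Require Import structures.
Require Import Defs.
From mathcomp Require Import all_boot all_algebra ring_quotient.
From mathcomp Require Import boolp classical_sets functions cardinality.
From mathcomp Require Import ring.

(* Over a Noetherian ring A, a weakly Laskerian module V has a finitely generated
   submodule L such that V/L has finite support; this is where the hypothesis on
   M is used, by a construction explained at [finite_ass_support].  Put
   S = R^*.  For a submodule K of M (x) S, an associated prime P of
   (M (x) S)/K is associated to the image of L (x) S in that quotient, or it lies
   in the support of (M (x) S)/(L (x) S).  There are finitely many P of the first
   kind because S is Noetherian.  Those of the second kind contract to one of the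
   finitely many primes p in the support of M/L, all of whose overprimes are
   again in this support.  If p is not the maximal ideal m, prime avoidance
   gives y in m such that m is the only prime containing p + (y); by Krull's
   principal ideal theorem the primes of S contracting to p are then minimal
   over pS, hence finite in number; over m there is only mS.  Flatness of S is
   never needed. *)

Set Implicit Arguments.
Unset Strict Implicit.
Unset Printing Implicit Defensive.

Import GRing.Theory.
Local Open Scope ring_scope.
Local Open Scope quotient_scope.
Local Open Scope classical_set_scope.

(** * Submodules, ideals and associated primes *)

Section Submodules.
Variables (A : comNzRingType) (V : lmodType A).
Implicit Types (N K L : set V) (v w : V) (s : seq V) (a b : A).

Definition submod N :=
  [/\ N 0, forall v w, N v -> N w -> N (v + w) & forall a v, N v -> N (a *: v)].

Definition adds N v := [set w | exists a, N (w - a *: v)].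

Definition spanl N s := foldr (fun v K => adds K v) N s.

(** The annihilator of the class of [v] in [V/N]. *)
Definition colon N v : set A := [set a | N (a *: v)].

Lemma submod0 N : submod N -> N 0. Proof. by case. Qed.
Lemma submodD N v w : submod N -> N v -> N w -> N (v + w).
Proof. by case=> _ + _; apply. Qed.
Lemma submodZ N a v : submod N -> N v -> N (a *: v).
Proof. by case=> _ _; apply. Qed.
Lemma submodN N v : submod N -> N v -> N (- v).
Proof. by move=> sN Nv; rewrite -scaleN1r; apply: submodZ. Qed.
Lemma submodB N v w : submod N -> N v -> N w -> N (v - w).
Proof. by move=> sN Nv Nw; apply: submodD => //; apply: submodN. Qed.
Lemma submodBK N v w : submod N -> N (v - w) -> N w -> N v.
Proof. by move=> sN Nvw Nw; rewrite -(subrK w v); apply: submodD. Qed.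

Lemma colon_eq N v w : submod N -> N (v - w) -> colon N v = colon N w.
Proof.
move=> sN Nvw; apply/seteqP; split=> b; rewrite /colon /= => Nb.
  by rewrite -[_ *: _](subKr (b *: v)) -scalerBr; apply: submodB => //; apply: submodZ.
by apply: (submodBK sN _ Nb); rewrite -scalerBr; apply: submodZ.
Qed.

Lemma submod_set0 : submod [set 0].
Proof.
split=> // [v w -> ->|a v ->] /=; first by rewrite addr0.
by rewrite scaler0.
Qed.

Lemma submod_adds N v : submod N -> submod (adds N v).
Proof.
move=> sN; split=> [|x y [a ax] [b bx]|c x [a ax]].
- by exists 0; rewrite scale0r subrr; apply: submod0.
- by exists (a + b); rewrite scalerDl opprD addrACA; apply: submodD.
- by exists (c * a); rewrite -scalerA -scalerBr; apply: submodZ.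
Qed.

Lemma sub_adds N v : N `<=` adds N v.
Proof. by move=> x Nx; exists 0; rewrite scale0r subr0. Qed.

Lemma mem_adds N v : submod N -> adds N v v.
Proof. by move=> sN; exists 1; rewrite scale1r subrr; apply: submod0. Qed.

Lemma adds_le N K v : N `<=` K -> adds N v `<=` adds K v.
Proof. by move=> NK x [a ax]; exists a; apply: NK. Qed.

Lemma adds_sub N K v : submod K -> N `<=` K -> K v -> adds N v `<=` K.
Proof.
by move=> sK NK Kv x [a /NK ax]; apply: submodBK ax _ => //; apply: submodZ.
Qed.

Lemma submod_spanl N s : submod N -> submod (spanl N s).
Proof. by move=> sN; elim: s => //= v s; apply: submod_adds. Qed.

Lemma sub_spanl N s : N `<=` spanl N s.
Proof. by elim: s => //= v s IH x /IH; apply: sub_adds. Qed.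

Lemma mem_spanl N s v : submod N -> v \in s -> spanl N s v.
Proof.
move=> sN; elim: s => //= w s IH; rewrite inE => /orP[/eqP->|/IH].
  by apply/mem_adds/submod_spanl.
exact: sub_adds.
Qed.

Lemma spanl_sub N K s : submod K -> N `<=` K -> (forall v, v \in s -> K v) ->
  spanl N s `<=` K.
Proof.
move=> sK NK; elim: s => //= v s IH Ks; apply: adds_sub => //.
  by apply: IH => w ws; apply: Ks; rewrite inE ws orbT.
by apply: Ks; rewrite inE eqxx.
Qed.

Lemma spanl_mono N s t : submod N -> {subset s <= t} -> spanl N s `<=` spanl N t.
Proof.
move=> sN st; apply: spanl_sub; first exact: submod_spanl.
  exact: sub_spanl.
by move=> v /st; apply: mem_spanl.
Qed.

Lemma spanl_sum N s v : submod N -> spanl N s v ->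
  exists d : nat -> A, N (v - \sum_(i < size s) d i *: s`_i).
Proof.
move=> sN; elim: s v => [|w s IH] v /=; first by exists (fun=> 0); rewrite big_ord0 subr0.
move=> [a /IH [d Nd]]; exists (fun i => if i is j.+1 then d j else a).
by rewrite big_ord_recl /= opprD addrA.
Qed.

Lemma submod_sum N n (d : 'I_n -> A) (f : 'I_n -> V) : submod N ->
  (forall i, N (f i)) -> N (\sum_i d i *: f i).
Proof.
move=> sN Nf; elim/big_ind: _ => [|x y|i _]; first exact: submod0.
  exact: submodD.
exact: submodZ.
Qed.

Lemma submod_bigcup (N : nat -> set V) : (forall n, submod (N n)) ->
  (forall n, N n `<=` N n.+1) -> submod (\bigcup_n N n).
Proof.
move=> sN Nle.
have {}Nle i j : (i <= j)%N -> N i `<=` N j.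
  by move/subnK <-; elim: (j - i)%N => // k IH x /IH; apply: Nle.
split=> [|x y [i _ Nx] [j _ Ny]|a x [i _ Nx]].
- by exists 0%N => //; apply: submod0.
- exists (maxn i j) => //; apply: submodD => //.
    by apply: Nle Nx; apply: leq_maxl.
  by apply: Nle Ny; apply: leq_maxr.
- by exists i => //; apply: submodZ.
Qed.

Lemma chain_stable (N : nat -> set V) s : (forall n, submod (N n)) ->
  (forall n, N n `<=` N n.+1) -> \bigcup_n N n = spanl [set 0] s ->
  exists n, forall k, N k `<=` N n.
Proof.
move=> sN Nle eqN.
have {}Nle i j : (i <= j)%N -> N i `<=` N j.
  by move/subnK <-; elim: (j - i)%N => // k IH x /IH; apply: Nle.
have Ns v : v \in s -> exists i, N i v.
  move=> /(mem_spanl submod_set0); rewrite -eqN => -[i _ Niv]; by exists i.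
have [n sNn] : exists n, forall v, v \in s -> N n v.
  elim: s Ns {eqN} => [|v s IH] Ns; first by exists 0%N.
  have [i Niv] := Ns v (mem_head _ _).
  have [|j Njs] := IH; first by move=> w ws; apply: Ns; rewrite inE ws orbT.
  exists (maxn i j) => w; rewrite inE => /orP[/eqP->|/Njs].
    by apply: Nle Niv; apply: leq_maxl.
  by apply: Nle; apply: leq_maxr.
exists n => k x Nkx; have : (\bigcup_n N n) x by exists k.
by rewrite eqN; apply: spanl_sub => // _ ->; apply: submod0.
Qed.

End Submodules.

Notation ideal I := (@submod _ (GRing.regular _) I).

(** * Prime ideals, Noetherian induction and associated primes *)

Section Ideals.
Variable A : comNzRingType.
Implicit Types (I J P Q : set A) (a b c : A).


Lemma idl_mull I a b : ideal I -> I b -> I (a * b).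
Proof. by move=> iI; apply: (submodZ a iI). Qed.
Lemma idl_mulr I a b : ideal I -> I a -> I (a * b).
Proof. by rewrite mulrC; apply: idl_mull. Qed.
Lemma idl0 I : ideal I -> I 0. Proof. by case. Qed.
Lemma idlD I a b : ideal I -> I a -> I b -> I (a + b).
Proof. exact: (@submodD A A^o). Qed.
Lemma idlB I a b : ideal I -> I a -> I b -> I (a - b).
Proof. exact: (@submodB A A^o). Qed.
Lemma idlBK I a b : ideal I -> I (a - b) -> I b -> I a.
Proof. exact: (@submodBK A A^o). Qed.
Lemma ideal_full I a : ideal I -> I 1 -> I a.
Proof. by move=> iI I1; rewrite -[a]mulr1; apply: idl_mull. Qed.

Lemma ideal_colon (V : lmodType A) (N : set V) v : submod N -> ideal (colon N v).
Proof.
move=> sN; rewrite /colon; split=> [|a b /= Na Nb|a b /= Nb] /=.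
- by rewrite scale0r; apply: submod0.
- by rewrite scalerDl; apply: submodD.
- by rewrite -scalerA; apply: submodZ.
Qed.

Definition primeI P :=
  [/\ ideal P, ~ P 1 & forall a b, P (a * b) -> P a \/ P b].

Lemma primeI_ideal P : primeI P -> ideal P. Proof. by case. Qed.
Lemma primeI_neq1 P : primeI P -> ~ P 1. Proof. by case. Qed.
Lemma primeIM P a b : primeI P -> P (a * b) -> P a \/ P b.
Proof. by case=> _ _; apply. Qed.
Lemma primeIMn P a b : primeI P -> ~ P a -> ~ P b -> ~ P (a * b).
Proof. by move=> pP Pa Pb /(primeIM pP)[]. Qed.
Lemma primeIX P a n : primeI P -> ~ P a -> ~ P (a ^+ n).
Proof.
move=> pP Pa; elim: n => [|n IH]; first by rewrite expr0; apply: primeI_neq1.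
by rewrite exprS; apply: primeIMn.
Qed.

Definition fg_ideal I := exists s : seq A^o, I = spanl [set 0] s.

Definition noeth := forall I, ideal I -> fg_ideal I.

Hypothesis noethA : noeth.

Lemma noeth_acc (I : nat -> set A) : (forall n, ideal (I n)) ->
  (forall n, I n `<=` I n.+1) -> exists n, forall k, I k `<=` I n.
Proof.
move=> iI Ile; have [s eqs] := noethA (submod_bigcup iI Ile).
exact: chain_stable iI Ile eqs.
Qed.

Lemma noeth_ind (T : set A -> Prop) :
  (forall I, ideal I ->
    (forall J, ideal J -> I `<=` J -> ~ J `<=` I -> T J) -> T I) ->
  forall I, ideal I -> T I.
Proof.
move=> indT I iI; apply: contrapT => nTI.
pose B := {J : set A | ideal J /\ ~ T J}.
have /choice[f fP] (J : B) : exists J' : B,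
    sval J `<=` sval J' /\ ~ sval J' `<=` sval J.
  case: J => J [iJ nTJ] /=; apply: contrapT => nex; apply: nTJ.
  apply: indT => // J' iJ' le nle; apply: contrapT => nTJ'.
  by apply: nex; exists (exist _ J' (conj iJ' nTJ')).
pose g n := sval (iter n f (exist _ I (conj iI nTI) : B)).
have [||n gn] := @noeth_acc g.
- by move=> n; rewrite /g; case: (iter _ _ _) => J [].
- by move=> n; have [] := fP (iter n f (exist _ I (conj iI nTI) : B)).
- have [_] := fP (iter n f (exist _ I (conj iI nTI) : B)); apply.
  exact: (gn n.+1).
Qed.

(** If [ab] annihilates [v] modulo [N] but [a] and [b] do not, then [bv] is still outside [N] and
    its annihilator is strictly larger, as it contains [a]. *)
Lemma exists_assoc (V : lmodType A) (N : set V) v : submod N -> ~ N v ->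
  exists c, primeI (colon N (c *: v)).
Proof.
move=> sN; suff H I : ideal I -> forall v, colon N v = I -> ~ N v ->
    exists c, primeI (colon N (c *: v)) by apply: H (erefl _); apply: ideal_colon.
move: I; apply: noeth_ind => I iI IH {}v eqI Nv.
have [pI|npI] := pselect (primeI I); first by exists 1; rewrite scale1r eqI.
have [a [b [Iab [Ia Ib]]]] : exists a b, I (a * b) /\ ~ I a /\ ~ I b.
  apply: contrapT => nex; apply: npI; split=> [//||a b Iab].
    by rewrite -eqI /colon /= scale1r.
  by apply: contrapT => /not_orP[Ia Ib]; apply: nex; exists a, b.
have [|||c pc] := IH (colon N (b *: v)) (ideal_colon _ sN) _ _ (b *: v) (erefl _).
- move=> x; rewrite -eqI /colon /= => Nx.
  by rewrite scalerA mulrC -scalerA; apply: submodZ.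
- by move=> /(_ a); rewrite /colon /= scalerA => h; apply/Ia/h; rewrite -eqI in Iab.
- by move: Ib; rewrite -eqI.
by exists (c * b); rewrite -scalerA.
Qed.

(** If [ab] lies in [I] but [a] and [b] do not, every prime over [I] lies over [I + (a)] or
    [I + (b)]; Noetherian induction applies to both. *)
Lemma minimal_primes I : ideal I -> exists F : set (set A),
  [/\ finite_set F, forall P, F P -> primeI P /\ I `<=` P &
      forall Q, primeI Q -> I `<=` Q -> exists2 P, F P & P `<=` Q].
Proof.
move: I; apply: noeth_ind => I iI IH.
have [I1|I1] := pselect (I 1).
  exists set0; split=> [|//|Q pQ IQ]; first exact: finite_set0.
  by case: (primeI_neq1 pQ); apply: IQ.
have [pI|npI] := pselect (primeI I).
  exists [set I]; split=> [|P ->|Q pQ IQ]; [exact: finite_set1|by split|by exists I].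
have [a [b [Iab [Ia Ib]]]] : exists a b, I (a * b) /\ ~ I a /\ ~ I b.
  apply: contrapT => nex; apply: npI; split=> // a b Iab.
  by apply: contrapT => /not_orP[Ia Ib]; apply: nex; exists a, b.
have bigger c : ~ I c -> exists F : set (set A),
  [/\ finite_set F, forall P, F P -> primeI P /\ I `<=` P &
      forall Q, primeI Q -> I `<=` Q -> Q c -> exists2 P, F P & P `<=` Q].
  move=> Ic; have [|||F [finF Fp FQ]] := IH (@adds A A^o I c).
  - exact: submod_adds.
  - exact: (@sub_adds A A^o I c).
  - by move/(_ c)=> h; apply/Ic/h; apply: (@mem_adds A A^o I c).
  exists F; split=> // [P /Fp[pP le]|Q pQ IQ Qc].
    by split=> // x Ix; apply/le/(@sub_adds A A^o).
  by apply: FQ => //; apply: (@adds_sub A A^o) => //; apply: primeI_ideal.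
have [F [finF Fp FQ]] := bigger a Ia; have [G [finG Gp GQ]] := bigger b Ib.
exists (F `|` G); split; first by rewrite finite_setU.
  by move=> P [/Fp|/Gp].
move=> Q pQ IQ; have [/(FQ Q pQ IQ)|/(GQ Q pQ IQ)] := primeIM pQ (IQ _ Iab).
  by move=> [P FP PQ]; exists P => //; left.
by move=> [P GP PQ]; exists P => //; right.
Qed.

(** For [N] inside [K] these are the associated primes of [K/N]; [K = setT] gives those of [V/N]. *)
Definition ass_in (V : lmodType A) (N K : set V) : set (set A) :=
  [set P | primeI P /\ exists2 w, K w & P = colon N w].

(** If some [c] outside [P] sends [w] into [K], then [cw] still has annihilator [P] modulo [N],
    because [P] is prime; otherwise the annihilator of [w] does not grow from [N] to [K]. *)
Lemma ass_split (V : lmodType A) (N K : set V) w P : submod N -> submod K ->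
  N `<=` K -> primeI P -> P = colon N w ->
  P = colon K w \/ exists2 v, K v & P = colon N v.
Proof.
move=> sN sK NK pP eP.
have [le|nle] := pselect (colon K w `<=` P).
  by left; apply/seteqP; split=> // a; rewrite eP; apply: NK.
right; have [c Kcw Pc] : exists2 c, K (c *: w) & ~ P c.
  by apply: contrapT => nex; apply: nle => c Kc; apply: contrapT => Pc; apply: nex; exists c.
exists (c *: w) => //; apply/seteqP; split=> a.
  move=> Pa; rewrite /colon /= scalerA mulrC -scalerA; apply: submodZ => //.
  by rewrite eP in Pa.
rewrite /colon /= scalerA => Nac; have : P (a * c) by rewrite eP.
by move/(primeIM pP) => [].
Qed.

(** Noetherian induction on the annihilator of [v]: an associated prime [P] gives a copy of [A/P]
    inside [(N + Av)/N], and dividing it out enlarges the annihilator. *)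
Lemma ass_cyclic (V : lmodType A) (N : set V) v : submod N ->
  finite_set (ass_in N (adds N v)).
Proof.
move=> sN; pose T I := forall (N : set V) v, submod N -> colon N v = I ->
  finite_set (ass_in N (adds N v)).
suff H I : ideal I -> T I by exact: (H _ (ideal_colon v sN) N v sN (erefl _)).
move: I; apply: noeth_ind => I iI IH {}N {}v {}sN eI.
have [->|/set0P[P [pP [w [a Na] eP]]]] := eqVneq (ass_in N (adds N v)) set0.
  exact: finite_set0.
have ePa : P = colon N (a *: v).
  by rewrite eP; apply: colon_eq.
pose N' := adds N (a *: v); have sN' : submod N' by apply: submod_adds.
have Nav : ~ N (a *: v) by move=> h; apply: (primeI_neq1 pP); rewrite ePa /colon /= scale1r.
have fin' : finite_set (ass_in N' (adds N' v)).
  apply: (IH (colon N' v) (ideal_colon _ sN') _ _ N' v sN' (erefl _)).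
    by rewrite -eI => b; apply: sub_adds.
  by move=> /(_ a)le; apply: Nav; rewrite -eI in le; apply/le/mem_adds.
apply: (@sub_finite_set _ _ ([set P] `|` ass_in N' (adds N' v))); last first.
  by rewrite finite_setU; split=> //; apply: finite_set1.
move=> Q [pQ [u Nu eQ]].
have [eQ'|[x [b Nb] eQx]] := ass_split sN sN' (@sub_adds _ _ N _) pQ eQ.
  right; split=> //; exists u => //; apply: adds_le Nu; exact: sub_adds.
(* [N'/N] is a copy of [A/P], where each nonzero element has annihilator [P]. *)
left=> /=; rewrite eQx.
have xE c : N (c *: x) <-> P (c * b).
  by rewrite ePa /colon /= -scalerA; have := colon_eq sN Nb; rewrite predeqE => /(_ c).
have Pb : ~ P b.
  move=> Pb; apply: (primeI_neq1 pQ); rewrite eQx; apply/xE; rewrite mul1r //.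
apply/seteqP; split=> c.
  by move=> /xE/(primeIM pP)[].
by move=> Pc; apply/xE; apply: idl_mulr => //; apply: primeI_ideal.
Qed.

Lemma ass_spanl (V : lmodType A) (N : set V) s : submod N ->
  finite_set (ass_in N (spanl N s)).
Proof.
move=> sN; elim: s => [|v s IH] /=.
  rewrite (_ : ass_in _ _ = set0); first exact: finite_set0.
  apply/seteqP; split=> // P [pP [w Nw eP]]; apply: (primeI_neq1 pP).
  by rewrite eP /colon /= scale1r.
apply: (@sub_finite_set _ _ (ass_in N (spanl N s) `|`
    ass_in (spanl N s) (adds (spanl N s) v))); last first.
  by rewrite finite_setU; split=> //; apply/ass_cyclic/submod_spanl.
move=> P [pP [w sw eP]].
have [e|[v' Kv' e]] := ass_split sN (submod_spanl s sN) (@sub_spanl _ _ N s) pP eP.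
  by right; split=> //; exists w.
by left; split=> //; exists v'.
Qed.

End Ideals.

(** * Krull's principal ideal theorem *)

Section KrullPrincipalIdeal.
Variable A : comNzRingType.
Hypothesis noethA : noeth A.
Implicit Types (I P Q m : set A) (a b c x z : A).

(** Says that [A/m] is a field or zero; properness of [m] is stated separately. *)
Definition local_at m := ideal m /\ forall a, ~ m a -> exists b, m (1 - b * a).

(** The hypotheses make [A/I] Artinian. In the induction on [I], take [a] outside [I] with [ma]
    inside [I]. If all [K n] contain [a], replace [I] by [I + (a)]; if not, the chain [K n + (a)]
    stabilises, and eventually [K n] meets [Aa] only inside [I]. *)
Lemma dcc_above m I (K : nat -> set A) : local_at m ->
  ideal I -> (forall P, primeI P -> I `<=` P -> m `<=` P) ->
  (forall n, ideal (K n)) -> (forall n, I `<=` K n) ->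
  (forall n, K n.+1 `<=` K n) ->
  exists n, forall k, K n `<=` K k.
Proof.
move=> [im mP] iI; move: I iI K; apply: (noeth_ind noethA) => I iI IH K Im iK IK Kle.
have Kge i j : (i <= j)%N -> K j `<=` K i.
  by move/subnK <-; elim: (j - i)%N => // k IHk x /Kle; apply: IHk.
have [I1|I1] := pselect (I 1).
  by exists 0%N => k x _; apply: ideal_full (iK k) _; apply: IK.
have [c pc] := exists_assoc noethA (V := A^o) iI I1.
set a : A := c *: (1 : A^o) in pc.
have Ia : ~ I a by move=> h; apply: (primeI_neq1 pc); rewrite /colon /= scale1r.
have ma b : m b -> I (b * a).
  apply: (Im _ pc) => x Ix; exact: (idl_mulr a iI Ix).
pose J := @adds A A^o I a.
have iJ : ideal J by apply: submod_adds.
have IJ : I `<=` J by apply: (@sub_adds A A^o).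
have IH' := IH J iJ IJ _.
have {}IH' : forall K : nat -> set A, (forall n, ideal (K n)) ->
    (forall n, J `<=` K n) -> (forall n, K n.+1 `<=` K n) ->
    exists n, forall k, K n `<=` K k.
  move=> K'; apply: IH'.
    by move/(_ a); apply: contra_not Ia; apply; apply: (@mem_adds A A^o).
  by move=> P pP /(subset_trans IJ); apply: Im.
have [aK|/existsNP[n1 aK]] := pselect (forall n, K n a).
  by apply: IH' => // n; apply: (@adds_sub A A^o).
have [|||n0 n0P] := IH' (fun n => @adds A A^o (K n) a).
- by move=> n; apply: submod_adds.
- by move=> n; apply: (@adds_le A A^o).
- by move=> n; apply: (@adds_le A A^o).
exists (maxn n0 n1) => k x Kx.
have [kle|/ltnW kle] := leqP k (maxn n0 n1); first exact: Kge kle _ Kx.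
have [t Kt] : adds (K k : set A^o) a x.
  by apply: n0P; apply: (@sub_adds A A^o); apply: Kge Kx; apply: leq_maxl.
have Kta : K (maxn n0 n1) (t * a).
  by rewrite -[t * a](subKr x); apply: (idlB (iK _) Kx); apply: Kge kle _ Kt.
have mt : m t.
  apply: contrapT => /mP[u mu]; apply: aK; apply: (Kge _ _ (leq_maxr n0 n1)).
  have -> : a = u * (t * a) + (1 - u * t) * a by ring.
  by apply: (idlD (iK _)); [apply: idl_mull|apply/IK/ma].
apply: (idlBK (iK k) Kt); exact/IK/ma.
Qed.

(** Krull's theorem in the domain [A/P], with [m] minimal over [x]. A nonzero [z] in [Q] is refuted
    through the saturated filtration by powers of [z], in place of symbolic powers of [Q]. *)
Lemma krull_principal m P Q x : local_at m -> ~ m 1 -> primeI P -> primeI Q ->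
  P `<=` Q -> Q `<=` m -> m x -> ~ Q x ->
  (forall T, primeI T -> P `<=` T -> T x -> m `<=` T) -> Q `<=` P.
Proof.
move=> mP m1 pP pQ PQ Qm mx Qx PxT z Qz; apply: contrapT => Pz.
have iP := primeI_ideal pP; have im := mP.1.
pose Z n := @adds A A^o P (z ^+ n); have iZ n : ideal (Z n) by apply: submod_adds.
have ZS n : Z n.+1 `<=` Z n.
  apply: (@adds_sub A A^o) => //; first exact: (@sub_adds A A^o).
  by rewrite exprS; apply: idl_mull => //; apply: (@mem_adds A A^o).
pose E n e : set A := [set a | Z n (x ^+ e * a)].
have iE n e : ideal (E n e).
  split=> [|a b|a b]; rewrite /E /=.
  - by rewrite mulr0; apply: idl0.
  - by rewrite mulrDr; apply: idlD.
  - by move=> Eb; rewrite (_ : _ * _ = a * (x ^+ e * b)); [apply: idl_mull|rewrite mulrCA].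
have EleS n e : E n e `<=` E n e.+1.
  by move=> a; rewrite /E /= exprS -mulrA; apply: idl_mull.
(* the [z]-adic filtration of [A / P], saturated with respect to [x] *)
pose J n : set A := \bigcup_e E n e.
have iJ n : ideal (J n) by apply: (@submod_bigcup A A^o).
have PJ n : P `<=` J n.
  by move=> a Pa; exists 0%N => //; apply: (@sub_adds A A^o); apply: idl_mull.
have JS n : J n.+1 `<=` J n by move=> a [e _ Ea]; exists e => //; apply: ZS.
have Jx n a : J n (x * a) -> J n a.
  by move=> [e _ Ea]; exists e.+1 => //; rewrite /E /= exprSr -mulrA.
(* Every prime over [P + (x)] contains [m], so the images of the [J n] modulo [x] become stationary;
   saturation then gives [J n = J n.+1 + x J n]. *)
have [n nP] : exists n, forall k, adds (J n : set A^o) x `<=` adds (J k : set A^o) x.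
  apply: (@dcc_above m (@adds A A^o P x)) => //.
  - exact: submod_adds.
  - move=> T pT PxT'; apply: PxT => //; last by apply/PxT'/(@mem_adds A A^o).
    by apply: subset_trans PxT'; apply: (@sub_adds A A^o).
  - by move=> k; apply: submod_adds.
  - by move=> k; apply: (@adds_le A A^o).
  - by move=> k; apply: (@adds_le A A^o).
have step a : J n a -> exists2 c, J n c & J n.+1 (a - c * x).
  move=> Ja; have [c Jc] := nP n.+1 a (@sub_adds A A^o _ _ _ Ja).
  exists c => //; apply: Jx; rewrite mulrC -[c * x](subKr a).
  by apply: idlB => //; apply: JS.
have iter_step i a : J n a -> exists2 c, J n c & J n.+1 (a - c * x ^+ i).
  elim: i a => [|i IH] a Ja.
    by exists a => //; rewrite expr0 mulr1 subrr; apply: idl0.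
  have [c Jc Jac] := IH a Ja; have [d Jd Jcd] := step c Jc; exists d => //.
  rewrite (_ : a - _ = (a - c * x ^+ i) + x ^+ i * (c - d * x)); last by rewrite exprS; ring.
  by apply: idlD => //; apply: idl_mull.
(* One exponent [e] suffices to saturate [Z n]; using [x^(e+1)] in [iter_step] leaves a spare factor
   [x]. *)
have [e eP] := noeth_acc noethA (iE n) (EleS n).
have Jz : J n (z ^+ n).
  by exists 0%N => //; rewrite /E /= mul1r; apply: (@mem_adds A A^o).
have [c [f _ Ec] Jc] := iter_step e.+1 _ Jz.
have [d Pd] := eP f c Ec; have [g _ [h Ph]] := Jc.
have {}Pd : P (x ^+ e * c - d * z ^+ n) by [].
have {}Ph : P (x ^+ g * (z ^+ n - c * x ^+ e.+1) - h * z ^+ n.+1) by [].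
(* Substituting [x^e c = d z^n] into [x^g (z^n - c x^(e+1)) = h z^(n+1)] modulo [P] lets [z^n] be
   cancelled; since [z] is in [Q] and [x] is not, this forces [1 - dx] into [Q]. *)
have PzQ : P (z ^+ n * (x ^+ g * (1 - d * x) - h * z)).
  rewrite (_ : _ * _ = x ^+ g * (z ^+ n - c * x ^+ e.+1) - h * z ^+ n.+1 +
    x ^+ g * x * (x ^+ e * c - d * z ^+ n)); last by rewrite !exprS; ring.
  by apply: idlD => //; apply: idl_mull.
have {PzQ}[/(primeIX pP Pz)//|/PQ Q1] := primeIM pP PzQ.
have iQ := primeI_ideal pQ.
have : Q (x ^+ g * (1 - d * x)).
  by apply: (idlBK iQ Q1); apply: idl_mull.
move/(primeIM pQ) => [/(primeIX pQ Qx)//|/Qm m1x]; apply: m1.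
by apply: (idlBK im m1x); apply: idl_mull.
Qed.

(** The witness is a product of elements outside [P], one from each ideal. The set [D] selects
    members of the list without filtering it. *)
Lemma avoid_prime (s : seq (set A)) (D : set (set A)) P :
  primeI P -> (forall I, I \in s -> D I -> ideal I /\ ~ I `<=` P) ->
  exists2 c, ~ P c & forall I, I \in s -> D I -> I c.
Proof.
move=> pP; elim: s => [|I s IH] sP; first by exists 1 => //; apply: primeI_neq1.
have [|c Pc cP] := IH; first by move=> J Js; apply: sP; rewrite inE Js orbT.
have [DI|DI] := pselect (D I); last first.
  by exists c => // J; rewrite inE => /orP[/eqP->//|]; apply: cP.
have [iI /existsNP[b /not_implyP[Ib Pb]]] := sP I (mem_head _ _) DI.
exists (b * c); first exact: primeIMn.
move=> J; rewrite inE => /orP[/eqP-> _|Js DJ]; first exact: idl_mulr.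
apply: idl_mull (cP _ Js DJ).
by have [] := sP J; rewrite ?inE ?Js ?orbT.
Qed.

Lemma prime_avoidance I (s : seq (set A)) (D : set (set A)) : ideal I ->
  (forall P, P \in s -> D P -> primeI P /\ ~ I `<=` P) ->
  exists2 c, I c & forall P, P \in s -> D P -> ~ P c.
Proof.
move=> iI; elim: s D => [|P s IH] D sP; first by exists 0 => //; apply: idl0.
have [DP|DP] := pselect (D P); last first.
  have [|c Ic cP] := IH D; first by move=> Q Qs; apply: sP; rewrite inE Qs orbT.
  by exists c => // Q; rewrite inE => /orP[/eqP->//|]; apply: cP.
(* Avoiding [P] also avoids the primes inside [P], so only the others are kept. *)
pose D' := D `&` [set Q | ~ Q `<=` P].
have sP' Q : Q \in s -> D' Q -> primeI Q /\ ~ I `<=` Q.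
  by move=> Qs [DQ _]; apply: sP => //; rewrite inE Qs orbT.
have [c Ic cP] := IH D' sP'.
suff [d Id [Pd dP]] : exists2 d, I d & ~ P d /\ forall Q, Q \in s -> D' Q -> ~ Q d.
  exists d => // Q; rewrite inE => /orP[/eqP->//|Qs DQ Qd].
  have [QP|QP] := pselect (Q `<=` P); first exact/Pd/QP.
  by apply: (dP Q Qs _ Qd); split.
have [Pc|Pc] := pselect (P c); last by exists c.
have [pP IP] := sP P (mem_head _ _) DP.
(* [d] lies in [I] and in the remaining primes but not in [P], while [c] lies in [P] and in none of
   them; hence [c + d] avoids all. *)
have [|d Pd dP] := @avoid_prime (I :: s) (D' `|` [set I]) P pP.
  move=> J; rewrite inE => /orP[/eqP-> _ //|Js [D'J|->]] //.
  by split; [apply: primeI_ideal; case: (sP' J Js D'J)|case: D'J].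
exists (c + d); first by apply: idlD => //; apply: dP; [rewrite mem_head|right].
split=> [Pcd|Q Qs D'Q Qcd].
  by apply: Pd; rewrite -(addKr c d) addrC; apply: idlB => //; apply: primeI_ideal.
have iQ : ideal Q by apply: primeI_ideal; case: (sP' Q Qs D'Q).
apply: (cP Q Qs D'Q); rewrite -(addrK d c); apply: idlB => //.
by apply: dP; [rewrite inE Qs orbT|left].
Qed.

End KrullPrincipalIdeal.

(** * Finite support *)

Section FiniteSupport.
Variables (A : comNzRingType) (V : lmodType A).
Hypothesis noethA : noeth A.
Implicit Types (N L : set V) (s : seq V) (p q : set A) (l : seq (set A * V)).
Implicit Types (px qy : set A * V).

(** The support of [V/N]: a class survives localisation at [p] exactly when its annihilator lies in
    [p]. *)
Definition supp N : set (set A) :=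
  [set p | primeI p /\ exists y, colon N y `<=` p].

Lemma supp_sub N L : N `<=` L -> supp L `<=` supp N.
Proof.
move=> NL p [pp [y yp]]; split=> //; exists y => a Na; exact/yp/NL.
Qed.

Lemma supp_specialize N p q : supp N p -> primeI q -> p `<=` q -> supp N q.
Proof.
by move=> [pp [y yp]] pq le; split=> //; exists y; apply: subset_trans le.
Qed.

Definition finite_ass := forall N, submod N -> (exists v, ~ N v) ->
  finite_set (ass_in N setT).

(* Adjoining [(p, x)] to [l] under [indep_step] adds a direct summand [A/p],
   generated by the class of [x], to [gen_span l / rel_span l]. *)
Definition gen_span l := spanl [set 0] (map snd l).

Definition rel_span l : set V :=
  foldr (fun (px : set A * V) K => [set w | exists a, px.1 a /\ K (w - a *: px.2)])
  [set 0] l.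

(** The second condition makes the primes distinct. The last one says that [Ax] meets [gen_span l]
    only inside [rel_span l]; with the third, no [r] outside [p] kills the new class. *)
Definition indep_step l px := [/\ primeI px.1, forall qy, qy \in l -> ~ qy.1 `<=` px.1,
  colon (gen_span l) px.2 `<=` px.1 &
  colon (gen_span l) px.2 `<=` colon (rel_span l) px.2].

Lemma submod_gen_span l : submod (gen_span l).
Proof. exact/submod_spanl/submod_set0. Qed.

Lemma submod_rel_span l : (forall px, px \in l -> ideal px.1) -> submod (rel_span l).
Proof.
elim: l => [|[p x] l IH] pl /=; first exact: submod_set0.
have ip : ideal p by apply: (pl (p, x)); apply: mem_head.
have {}IH : submod (rel_span l) by apply: IH => qy lqy; apply: pl; rewrite inE lqy orbT.
split=> [|v w [a [pa Na]] [b [pb Nb]]|c v [a [pa Na]]].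
- exists 0; split; first exact: idl0.
  by rewrite scale0r subrr; apply: submod0.
- exists (a + b); split; first exact: idlD.
  by rewrite scalerDl opprD addrACA; apply: submodD.
- exists (c * a); split; first exact: idl_mull.
  by rewrite -scalerA -scalerBr; apply: submodZ.
Qed.

Lemma rel_sub_gen l : rel_span l `<=` gen_span l.
Proof. by elim: l => //= px l IH v [a [_ /IH]]; exists a. Qed.

Lemma rel_sub_cons px l : ideal px.1 -> rel_span l `<=` rel_span (px :: l).
Proof.
move=> ip v Nv; exists 0; split; first exact: idl0.
by rewrite scale0r subr0.
Qed.

Lemma rel_cons_gen l px v : (forall qy, qy \in l -> ideal qy.1) -> indep_step l px ->
  rel_span (px :: l) v -> gen_span l v -> rel_span l v.
Proof.
move=> il [_ _ _ LN] [a [pa Na]] Lv; have sN := submod_rel_span il.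
apply: (submodBK sN Na); apply: LN => /=; rewrite /colon /=.
rewrite -[_ *: _](subKr v); apply: submodB (submod_gen_span l) Lv _.
exact: rel_sub_gen Na.
Qed.

Lemma colon_rel_cons l px : (forall qy, qy \in l -> ideal qy.1) -> indep_step l px ->
  colon (rel_span (px :: l)) px.2 = px.1.
Proof.
move=> il [pp _ Lp _]; have ip := primeI_ideal pp.
apply/seteqP; split=> r.
  move=> [a [pa Na]]; apply: (idlBK ip _ pa); apply: Lp.
  by rewrite /colon /= scalerBl; apply: rel_sub_gen.
move=> pr; exists r; split=> //; rewrite subrr; apply: submod0; exact: submod_rel_span.
Qed.

Lemma rel_span_scale l b v : (forall px, px \in l -> px.1 b) ->
  (forall px, px \in l -> ideal px.1) -> gen_span l v -> rel_span l (b *: v).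
Proof.
elim: l v => [|px l IH] v sl il /=; first by move=> ->; rewrite scaler0.
move=> [a La]; exists (b * a); split.
  by apply: idl_mulr; [apply: il|apply: sl]; apply: mem_head.
rewrite -scalerA -scalerBr; apply: IH La => qy lqy; [apply: sl|apply: il];
  by rewrite inE lqy orbT.
Qed.

(** Choose [b] outside [p] but in all earlier primes; it kills [gen_span l] modulo [rel_span l].
    Take [x = b^n y] with [n] so large that its annihilator modulo [rel_span l] is stationary: if
    [rx] is in [gen_span l], then [brx], hence [rx], is in [rel_span l]. *)
Lemma indep_extend l p : (forall qy, qy \in l -> ideal qy.1) ->
  supp (gen_span l) p -> (forall qy, qy \in l -> ~ qy.1 `<=` p) ->
  exists x, indep_step l (p, x).
Proof.
move=> il [pp [y yp]] lp; have sN := submod_rel_span il.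
have [|b pb bl] := @avoid_prime A (map fst l) setT p pp.
  by move=> I /mapP[qy lqy ->] _; split; [apply: il|apply: lp].
have [||n nP] := @noeth_acc A noethA (fun n => colon (rel_span l) (b ^+ n *: y)).
- by move=> n; apply: ideal_colon.
- move=> n a; rewrite /colon /= => Na.
  rewrite (_ : a *: _ = b *: (a *: (b ^+ n *: y))); first exact: submodZ.
  by rewrite exprS !scalerA; congr (_ *: _); ring.
exists (b ^+ n *: y); split=> //= r; rewrite /colon /= => Lr.
  have : p (r * b ^+ n) by apply: yp; rewrite /colon /= -scalerA.
  by move=> /(primeIM pp)[//|/(primeIX pp pb)].
apply: (nP n.+1); rewrite /colon /=.
rewrite (_ : r *: _ = b *: (r *: (b ^+ n *: y))); last first.
  by rewrite exprS !scalerA; congr (_ *: _); ring.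
apply: rel_span_scale => // qy lqy; apply: bl => //; exact: map_f.
Qed.

(* Let [q] be maximal among the ideals [q] such that all [V/L] with [L] finitely
   generated have infinite support inside [V(q)]; if a prime [p] contains [q]
   strictly, then almost all of the support of some [V/L] in [V(q)] avoids
   [V(p)].  So one can choose successively primes [p_n] in [V(q)], none of which
   contains an earlier one, and elements [x_n] spanning a direct sum of copies
   of the [A/p_n] modulo the submodule spanned by the [p_n x_n]. *)
Lemma finite_ass_support : finite_ass ->
  exists s, finite_set (supp (spanl [set 0] s)).
Proof.
move=> finA; apply: contrapT => /forallNP infs.
pose bad q := forall s, infinite_set (supp (spanl [set 0] s) `&` [set p | q `<=` p]).
have [q [iq bq qmax]] : exists q, [/\ ideal q, bad q &
    forall J, ideal J -> q `<=` J -> ~ J `<=` q -> ~ bad J].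
  apply: contrapT => nex.
  (* The zero ideal is bad because every prime contains it; without a maximal bad ideal, Noetherian
     induction would show that none is bad. *)
  suff H q : ideal q -> ~ bad q.
    apply: (H [set 0] (@submod_set0 A A^o)) => s; apply: contra_not (infs s).
    apply: sub_finite_set => p sp; split=> // _ ->.
    by case: sp => /primeI_ideal/idl0.
  apply: (noeth_ind noethA (T := fun q => ~ bad q)) => {}q iq IH bq.
  by apply: nex; exists q.
pose inv l := forall px, px \in l -> [/\ primeI px.1, q `<=` px.1 & px.1 <> q].
have next l : inv l -> exists px, indep_step l px /\ inv (px :: l).
  move=> il.
  have il' qy : qy \in l -> ideal qy.1 by move=> /il[/primeI_ideal].
  (* Each earlier prime strictly contains [q] and so is not bad; enlarging the submodule only
     shrinks supports, so one list serves for all of them. *)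
  have [s' s'P] : exists s', forall px, px \in l ->
      finite_set (supp (spanl [set 0] s') `&` [set p | px.1 `<=` p]).
    elim: l il {il'} => [|px l IH] il; first by exists [::].
    have [|s' s'P] := IH; first by move=> qy lqy; apply: il; rewrite inE lqy orbT.
    have [pp qp pq] := il px (mem_head _ _).
    have /existsNP[s'' /contrapT s''P] : ~ bad px.1.
      apply: qmax => //; first exact: primeI_ideal.
      by move=> pq'; apply: pq; apply/seteqP.
    exists (s' ++ s'') => qy; rewrite inE => /orP[/eqP->|lqy].
      apply: sub_finite_set s''P => p [sp le]; split=> //; apply: supp_sub sp.
      by apply: spanl_mono (@submod_set0 _ V) _ => v vs; rewrite mem_cat vs orbT.
    apply: sub_finite_set (s'P _ lqy) => p [sp le]; split=> //; apply: supp_sub sp.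
    by apply: spanl_mono (@submod_set0 _ V) _ => v vs; rewrite mem_cat vs.
  (* Including the earlier generators puts [p] into the support modulo [gen_span l]. Such a [p]
     exists: infinitely many primes are available, and only finitely many are [q] or contain an
     earlier prime. *)
  pose s := map snd l ++ s'.
  have [p [[sp qp] pP]] : exists p, (supp (spanl [set 0] s) `&` [set p | q `<=` p]) p /\
     ~ (p = q \/ exists2 px, px \in l & px.1 `<=` p).
    apply: contrapT => /forallNP nex; apply: (bq s).
    apply: (@sub_finite_set _ _ ([set q] `|` \bigcup_(px in [set` l])
      (supp (spanl [set 0] s') `&` [set p | px.1 `<=` p]))).
      move=> p sqp; have /not_andP[//|/contrapT[->|[px lpx le]]] := nex p; first by left.
      right; exists px => //; split=> //; apply: supp_sub sqp.1.
      by apply: spanl_mono (@submod_set0 _ V) _ => v vs; rewrite mem_cat vs orbT.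
    rewrite finite_setU; split; first exact: finite_set1.
    by apply: bigcup_finite => // px lpx; apply: s'P.
  have pp : primeI p by case: sp.
  have [||x gx] := indep_extend (l := l) (p := p) il'.
  - apply: supp_sub sp; apply: spanl_mono (@submod_set0 _ V) _ => v vs.
    by rewrite mem_cat vs.
  - by move=> qy lqy le; apply: pP; right; exists qy.
  exists (p, x); split=> // qy; rewrite inE => /orP[/eqP->|/il//] /=.
  by split=> // e; apply: pP; left.
pose T := {l | inv l}.
have /choice[f fP] (t : T) : exists px, indep_step (sval t) px /\ inv (px :: sval t).
  by case: t => l il; apply: next.
have inv0 : inv [::] by [].
pose g n : T := iter n (fun t => exist inv (f t :: sval t) (fP t).2) (exist inv [::] inv0).
pose l n := sval (g n); pose px n := f (g n).
have il n : inv (l n) by rewrite /l; case: (g n).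
have il' n qy : qy \in l n -> ideal qy.1 by move=> /il[/primeI_ideal].
have lS n : l n.+1 = px n :: l n by [].
have gl n : indep_step (l n) (px n) by case: (fP (g n)).
clearbody px l; have pxl i j : (i < j)%N -> px i \in l j.
  elim: j => // j IH; rewrite ltnS leq_eqVlt lS inE => /orP[/eqP->|/IH->].
    by rewrite eqxx.
  by rewrite orbT.
have NS n : rel_span (l n) `<=` rel_span (l n.+1).
  by rewrite lS; apply: rel_sub_cons; case: (gl n) => /primeI_ideal.
have LS i j : (i <= j)%N -> gen_span (l i) `<=` gen_span (l j).
  by move/subnK <-; elim: (j - i)%N => // k IH v /IH; rewrite addSn lS; apply: sub_adds.
pose N := \bigcup_n rel_span (l n).
have sN : submod N by apply: submod_bigcup => // n; apply: submod_rel_span; apply: il'.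
(* Later relations add nothing inside [gen_span (l i.+1)], so the annihilator of [x_i] modulo the
   union of all relations is still [p_i]. *)
have Npx i : colon N (px i).2 = (px i).1.
  rewrite -[RHS](colon_rel_cons (@il' i) (gl i)) -lS.
  apply/seteqP; split=> r; rewrite /colon /=; last by move=> Nr; exists i.+1.
  move=> [j _]; have [ij|/ltnW ji] := leqP i.+1 j; last first.
    move/subnK: ji => <-; elim: (i.+1 - j)%N => // k IH /IH; exact: NS.
  have Lr : gen_span (l i.+1) (r *: (px i).2).
    apply: submodZ; first exact: submod_gen_span.
    by rewrite lS; apply: (mem_adds (px i).2 (submod_gen_span (l i))).
  move/subnK: ij => <-; elim: (j - i.+1)%N => // k IH; rewrite addSn lS => Nr.
  by apply/IH/(rel_cons_gen (@il' _) (gl _) Nr); apply: LS Lr; apply: leq_addl.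
have finN : finite_set (ass_in N setT).
  apply: finA => //; exists (px 0%N).2 => N1; have [pp _ _ _] := gl 0%N.
  by apply: (primeI_neq1 pp); rewrite -Npx /colon /= scale1r.
apply: infinite_nat; rewrite -(_ : (fun n => (px n).1) @^-1` ass_in N setT = setT).
  apply: finite_preimage finN => i j _ _ /= eij; apply: contrapT => /eqP.
  rewrite neq_ltn => /orP[] /pxl lpx.
    by case: (gl j) => _ /(_ _ lpx) + _ _; rewrite eij; apply.
  by case: (gl i) => _ /(_ _ lpx) + _ _; rewrite eij; apply.
apply/seteqP; split=> // n _; split; first by case: (gl n).
by exists (px n).2 => //; rewrite Npx.
Qed.

End FiniteSupport.

(** * Subsets as submodules and ideals *)

Section SubmodClosedOfSet.
Variables (A : comNzRingType) (V : lmodType A) (K : set V) (sK : submod K).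

(** The proof of closure is an argument so that the submodule structure can be inferred from the
    term. *)
Definition submod_mem of submod K : {pred V} := fun v => `[<K v>].

Lemma submod_memP v : reflect (K v) (v \in submod_mem sK).
Proof. exact: asboolP. Qed.

Fact submod_mem_closed : subsemimod_closed (submod_mem sK).
Proof.
case: (sK) => K0 KD KZ; split; first split; first exact/submod_memP.
  by move=> x y /submod_memP Kx /submod_memP Ky; apply/submod_memP/KD.
by move=> a x /submod_memP Kx; apply/submod_memP/KZ.
Qed.

HB.instance Definition _ :=
  GRing.isSubmodClosed.Build A V (submod_mem sK) submod_mem_closed.

End SubmodClosedOfSet.

Section IdealrOfSet.
Variables (A : comNzRingType) (I : set A) (iI : ideal I) (I1 : ~ I 1).

Definition idealr_mem of ideal I & ~ I 1 : {pred A} := fun a => `[<I a>].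

Lemma idealr_memP a : reflect (I a) (a \in idealr_mem iI I1).
Proof. exact: asboolP. Qed.

Fact idealr_mem_closed : idealr_closed (idealr_mem iI I1).
Proof.
split; [by apply/idealr_memP; exact: (idl0 iI)|exact/idealr_memP|].
move=> a u v /idealr_memP Iu /idealr_memP Iv.
by apply/idealr_memP; apply: (idlD iI _ Iv); apply: (idl_mull a iI Iu).
Qed.

HB.instance Definition _ := isIdealr.Build A (idealr_mem iI I1) idealr_mem_closed.

End IdealrOfSet.

(** * Agreement of the set-based notions with those of the statement *)

Section Translation.
Variables (A : comNzRingType) (V : lmodType A).

Lemma submod_span_min (S K : set V) v : submod K -> S `<=` K ->
  v \in submod_span S -> K v.
Proof.
move=> sK SK /submod_spanP/(_ (submod_mem sK)) h; apply/(submod_memP sK)/h.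
by move=> a /SK/(submod_memP sK).
Qed.

Lemma submod_of_closed (N : submodClosed V) : submod [set v | v \in N].
Proof.
by split=> [|v w|a v] /=; [exact: rpred0|exact: rpredD|exact: rpredZ].
Qed.

Lemma prime_idealE (p : set A) : prime_ideal p <-> primeI p.
Proof.
have inP a : (a \in [in p]) <-> p a by split=> [/set_mem//|pa]; apply: mem_set.
split=> [[[/inP p0 /negP p1 pD] pM]|[ip p1 pM]].
  have pD' a u v : p u -> p v -> p (a * u + v).
    by move=> pu pv; apply/inP/pD; apply/inP.
  split=> [||a b /inP/pM/orP[]/inP]; [|by move/inP|by left|by right].
  split=> // [a b pa pb|a b pb]; first by rewrite -[a]mul1r; apply: pD'.
  by rewrite -[_ *: _]addr0; apply: pD'.
split; first split.
- by apply/inP; apply: (idl0 ip).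
- by apply/negP => /inP.
- by move=> a u v /inP pu /inP pv; apply/inP/(idlD ip _ pv)/(idl_mull a ip pu).
by move=> u v /inP/pM[] h; apply/orP; [left|right]; apply/inP.
Qed.

Lemma ann_quotmod (N : submodClosed V) v :
  ann (quotmod_pi N v) = colon [set u | u \in N] v.
Proof.
have e a : (a *: quotmod_pi N v = 0) <-> (a *: v \in N).
  rewrite -linearZ -(raddf0 (quotmod_pi N)); split=> [/quotmod_piP|h].
    by rewrite subr0.
  by apply/quotmod_piP; rewrite subr0.
by apply/seteqP; split=> a /e.
Qed.

Lemma Ass_quotmod (N : submodClosed V) :
  Ass (quotmod N) = ass_in [set v | v \in N] setT.
Proof.
apply/seteqP; split=> p [pp [x]].
  rewrite -(quotmod_repr x) ann_quotmod => e.
  by split; [apply/prime_idealE|exists (repr x)].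
move=> _ e; split; first exact/prime_idealE.
by exists (quotmod_pi N x); rewrite ann_quotmod.
Qed.

Lemma weakly_laskerianE : weakly_laskerian V <-> finite_ass V.
Proof.
split=> [wl N sN [v Nv]|fA N [x Nx]].
  have := wl (submod_mem sN).
  rewrite Ass_quotmod (_ : [set v | _] = N); last first.
    by apply/seteqP; split=> u /(submod_memP sN).
  by apply; exists v; apply/negP => /(submod_memP sN).
rewrite Ass_quotmod; apply: fA; first exact: submod_of_closed.
by exists x; apply/negP.
Qed.

End Translation.

Lemma noetherian_noeth (A : comNzRingType) : noetherian A -> noeth A.
Proof.
move=> noethA I iI; have [s sP] := noethA (submod_mem iI); exists s.
apply/seteqP; split=> a.
  move/(submod_memP iI); rewrite sP; apply: submod_span_min.
    exact/submod_spanl/submod_set0.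
  by move=> b; apply: mem_spanl; apply: submod_set0.
apply: (@spanl_sub A A^o) => // [_ ->|b bs]; first exact: idl0.
by apply/(submod_memP iI); rewrite sP; apply: mem_submod_span.
Qed.

(** * Proper ideals and units of a Noetherian local ring *)

Section LocalRing.
Variables (R : comNzRingType) (m : idealr R).
Hypotheses (noethR : noeth R) (localR : local_ring m).

Lemma ideal_max : ideal [set a | a \in m].
Proof. exact: (submod_of_closed (idealr_pred m)). Qed.

Lemma proper_sub_max I : ideal I -> ~ I 1 -> I `<=` [set a | a \in m].
Proof.
move: I; apply: (noeth_ind noethR) => I iI IH I1.
have [[J [iJ IJ JI J1]]|nex] :=
  pselect (exists J, [/\ ideal J, I `<=` J, ~ J `<=` I & ~ J 1]).
  exact: subset_trans IJ (IH J iJ IJ JI J1).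
have maxI : maximal_ideal (idealr_mem iI I1).
  move=> J IJ x; apply/idP/idP; last exact: IJ.
  have iJ : ideal [set a | a \in J] := submod_of_closed (idealr_pred J).
  move=> Jx; apply/idealr_memP; apply: contrapT => Ix; apply: nex.
  exists [set a | a \in J]; split=> //.
  - by move=> a Ia; apply/IJ/idealr_memP.
  - by move=> JI; apply/Ix/JI.
  - by apply/negP; rewrite idealr1.
by move=> a Ia /=; rewrite -(localR.2 _ maxI); apply/idealr_memP.
Qed.

Lemma max_unit a : a \notin m -> exists b, b * a = 1.
Proof.
move=> ma; pose I := @adds R R^o [set 0] a.
have iI : ideal I by apply/submod_adds/submod_set0.
have [[b /eqP]|I1] := pselect (I 1).
  by rewrite subr_eq0 => /eqP e; exists b; rewrite [RHS]e.
case/negP: ma; apply: (proper_sub_max iI I1).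
exact/mem_adds/submod_set0.
Qed.

End LocalRing.

(** * The adic filtration of the completion *)

Section CompletionOfIdeal.
Variables (R : comNzRingType) (m : idealr R).
Local Notation C := (completion m).
Local Notation Q n := {ideal_quot (adic_ideal m n)}.
Local Notation iota := (@to_completion R m).
Implicit Types (u v w : C) (a b : R).

Lemma pi_eq0 n a : (\pi_(Q n) a = 0) <-> (a \in adic_ideal m n).
Proof.
rewrite -(rmorph0 \pi_(Q n)) -{2}[a]subr0 Quotient.idealrBE.
by split=> [/eqP|/eqP].
Qed.

Lemma proj_down u n k a : (k <= n)%N -> u n = \pi_(Q n) a -> u k = \pi_(Q k) a.
Proof.
move/subnK <-; elim: (n - k)%N => // d IH e; apply: IH.
by rewrite -adic_projP e adic_transE.
Qed.

(** The kernel of the map from the completion to [R/m^n]; the indices shift because component [k]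
    lies in [R/m^(k+1)]. *)
Definition adic_filter n : set C := if n is k.+1 then [set u | u k = 0] else setT.

Lemma ideal_filter n : ideal (adic_filter n).
Proof.
case: n => [|n]; split=> //=.
- by move=> u v /= u0 v0; rewrite u0 v0 addr0.
- by move=> u v /= v0; rewrite v0 mulr0.
Qed.

Lemma filter_le i j : (i <= j)%N -> adic_filter j `<=` adic_filter i.
Proof.
case: i j => [|i] [|j] //= ij u uj.
by rewrite (@proj_down u j i 0) // ?rmorph0.
Qed.

Lemma filter_eq0 u : (forall n, adic_filter n u) -> u = 0.
Proof. by move=> Fu; apply: completionP => n; apply: (Fu n.+1). Qed.

Lemma filter_iota n a : a \in ideal_exp m n -> adic_filter n (iota a).
Proof. by case: n => [|n] //= an; apply/pi_eq0. Qed.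

Lemma filter1M n u v : adic_filter 1 u -> adic_filter n v ->
  adic_filter n.+1 (u * v).
Proof.
move=> /= u0 vn.
have ru : u n = \pi_(Q n) (repr (u n)) by rewrite reprK.
have rv : v n = \pi_(Q n) (repr (v n)) by rewrite reprK.
rewrite ru rv -rmorphM; apply/pi_eq0.
have mu : repr (u n) \in m.
  apply: (@adic_ideal_sub R m 0); apply/pi_eq0.
  by rewrite -(proj_down (leq0n n) ru).
suff mv : repr (v n) \in ideal_exp m n.
  by apply: mem_submod_span; exists (repr (u n)) => //; exists (repr (v n)).
case: n vn {ru mu} rv => [|n] //= vn rv.
by apply/pi_eq0; rewrite -(proj_down (leqnSn n) rv).
Qed.

Lemma filterX n u : adic_filter 1 u -> adic_filter n (u ^+ n).
Proof.
by move=> Fu; elim: n => // n IH; rewrite exprS; apply: filter1M.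
Qed.

Lemma filter_lim (E : nat -> C) :
  (forall n, adic_filter n (E n.+1 - E n)) ->
  exists e, forall n, adic_filter n (e - E n).
Proof.
(* Component [n] of the sequence is constant from [E n.+1] on. *)
move=> FE; pose e n : Q n := E n.+1 n.
have eP n : adic_trans (e n.+1) = e n.
  by rewrite /e adic_projP; apply/eqP; rewrite -subr_eq0; apply/eqP/(FE n.+1).
exists (Completion eP) => -[|n] //=.
by rewrite /e subrr.
Qed.

(** Successive approximation: the remainders stay in [H n], hence tend to zero, and the coefficients
    converge because their increments lie in [adic_filter n]. *)
Lemma filter_gen k (f : 'I_k -> C) (H : nat -> set C) :
  (forall n, H n `<=` adic_filter n) ->
  (forall n u, H n u -> exists d : 'I_k -> C,
    (forall i, adic_filter n (d i)) /\ H n.+1 (u - \sum_i d i * f i)) ->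
  forall u, H 0%N u -> exists d : 'I_k -> C, u = \sum_i d i * f i.
Proof.
move=> HF Hstep u H0u.
have /choice[D DP] (nv : nat * C) : exists d : 'I_k -> C, H nv.1 nv.2 ->
    (forall i, adic_filter nv.1 (d i)) /\ H nv.1.+1 (nv.2 - \sum_i d i * f i).
  have [/Hstep[d dP]|nH] := pselect (H nv.1 nv.2); first by exists d.
  by exists (fun=> 0).
pose g := fix g n := if n is k.+1 then g k - \sum_i D (k, g k) i * f i else u.
have Hg n : H n (g n) by elim: n => //= n /(DP (n, g n))[].
pose E i n : C := \sum_(j < n) D (nat_of_ord j, g j) i.
have gE n : g n = u - \sum_i E i n * f i.
  elim: n => [|n IH /=].
    by rewrite big1 ?subr0 // => i _; rewrite /E big_ord0 mul0r.
  rewrite {1}IH -addrA -opprD -big_split /=; congr (_ - _).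
  by apply: eq_bigr => i _; rewrite /E big_ord_recr /= mulrDl.
have /choice[e eP] (i : 'I_k) : exists e, forall n, adic_filter n (e - E i n).
  apply: filter_lim => n; rewrite /E big_ord_recr /= addrAC subrr add0r.
  by have [+ _] := DP (n, g n) (Hg n); apply.
exists e; apply/eqP; rewrite -subr_eq0; apply/eqP/filter_eq0 => n.
have -> : u - \sum_i e i * f i = g n - \sum_i f i * (e i - E i n).
  rewrite gE -addrA -opprD -big_split /=; congr (_ - _).
  by apply: eq_bigr => i _; ring.
apply: (idlB (ideal_filter n)); first exact/HF/Hg.
elim/big_ind: _ => [|x y|i _]; first exact: (idl0 (ideal_filter n)).
  exact: (idlD (ideal_filter n)).
exact: (idl_mull _ (ideal_filter n) (eP i n)).
Qed.

Lemma ideal_mul_sum (s : seq R^o) n :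
  [set a | a \in m] = spanl [set 0] s -> forall a,
  a \in ideal_exp m n.+1 ->
  exists2 d : 'I_(size s) -> R, forall i, d i \in ideal_exp m n &
    a = \sum_i d i * s`_i.
Proof.
move=> ms; have Jn : ideal [set a | a \in ideal_exp m n].
  case: n => [|n]; first by split.
  exact: (ideal_max (adic_ideal m n)).
pose K : set R := [set a | exists2 d : 'I_(size s) -> R,
  forall i, d i \in ideal_exp m n & a = \sum_i d i * s`_i].
have iK : ideal K.
  split=> [|_ _ [d dn ->] [e en ->]|a _ [d dn ->]].
  - exists (fun=> 0) => [i|]; first exact: (idl0 Jn).
    by rewrite big1 // => i _; rewrite mul0r.
  - exists (fun i => d i + e i) => [i|]; first exact: (idlD Jn (dn i) (en i)).
    by rewrite -big_split; apply: eq_bigr => i _; rewrite mulrDl.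
  - exists (fun i => a * d i) => [i|]; first exact: (idl_mull a Jn (dn i)).
    by rewrite [_ *: _]mulr_sumr; apply: eq_bigr => i _; rewrite mulrA.
move=> a; apply: (@submod_span_min R R^o _ K) => // _ [b mb [c cn <-]].
have : spanl [set 0] s b by rewrite -ms; exact: mb.
move/(spanl_sum (@submod_set0 _ R^o)) => [d /eqP]; rewrite subr_eq0 => /eqP ->.
exists (fun i => c * d i) => [i|]; first exact: (idl_mulr _ Jn cn).
rewrite mulr_suml; apply: eq_bigr => i _.
by rewrite [_ *: _]/GRing.scale /= mulrC mulrA.
Qed.

(** Approximating [u] by an element of [m^(n+1)], written in the generators of [m] with coefficients
    in [m^n], improves the remainder by one step of the filtration. *)
Lemma filter1_gen (s : seq R^o) : [set a | a \in m] = spanl [set 0] s ->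
  forall u, adic_filter 1 u ->
  exists d : 'I_(size s) -> C, u = \sum_i d i * iota s`_i.
Proof.
move=> ms; apply: (@filter_gen _ _ (fun n => adic_filter n.+1)).
  by move=> n; apply: filter_le.
move=> n u un; have ru : u n.+1 = \pi_(Q n.+1) (repr (u n.+1)) by rewrite reprK.
have rn : repr (u n.+1) \in ideal_exp m n.+1.
  by apply/pi_eq0; rewrite -(proj_down (leqnSn n) ru).
have [d dn e] := ideal_mul_sum ms rn.
exists (fun i => iota (d i)); split=> [i|]; first exact: filter_iota.
rewrite (_ : \sum_i _ = iota (repr (u n.+1))); first by rewrite /= -ru subrr.
by rewrite e rmorph_sum; apply: eq_bigr => i _; rewrite rmorphM.
Qed.

End CompletionOfIdeal.

(** * The completion of a Noetherian local ring *)

Section CompletionLocalNoetherian.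
Variables (R : comNzRingType) (m : idealr R).
Hypotheses (noethR : noeth R) (localR : local_ring m).
Local Notation C := (completion m).
Local Notation Q n := {ideal_quot (adic_ideal m n)}.
Local Notation iota := (@to_completion R m).
Local Notation max_completion := (@adic_filter R m 1).
Implicit Types (u v w : C) (a b : R) (I J P : set C).

(** Every component of [u] lifts to an element outside [m], hence is invertible; uniqueness of
    inverses makes them compatible with the transition maps. *)
Lemma completion_unit u : ~ max_completion u -> exists v, v * u = 1.
Proof.
move=> u0.
have /choice[r rP] n : exists b, \pi_(Q n) b * u n = 1.
  have ru : u n = \pi_(Q n) (repr (u n)) by rewrite reprK.
  have [|b e] := @max_unit R m noethR localR (repr (u n)).
    apply/negP => mr; apply: u0 => /=.
    rewrite (proj_down (leq0n n) ru); apply/pi_eq0.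
    by apply: mem_submod_span; exists (repr (u n)) => //; exists 1; rewrite ?mulr1.
  by exists b; rewrite {1}ru -rmorphM e rmorph1.
have vP n : adic_trans (\pi_(Q n.+1) (r n.+1)) = \pi_(Q n) (r n).
  have e : adic_trans (\pi_(Q n.+1) (r n.+1)) * u n = 1.
    by rewrite -(adic_projP u) -rmorphM rP rmorph1.
  by rewrite -[LHS]mulr1 -(rP n) mulrCA e mulr1.
by exists (Completion vP); apply: completionP => n /=; apply: rP.
Qed.

Lemma local_at_completion : local_at max_completion.
Proof.
split; first exact: ideal_filter.
by move=> u /completion_unit[v e]; exists v; rewrite e subrr.
Qed.

Lemma max_completion_neq1 : ~ max_completion 1.
Proof. by move=> /eqP; rewrite (negPf (oner_neq0 (Q 0))). Qed.

Lemma proper_sub_filter1 I : ideal I -> ~ I 1 -> I `<=` max_completion.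
Proof.
move=> iI I1 u Iu; apply: contrapT => /completion_unit[v e].
by apply: I1; rewrite -e; apply: idl_mull.
Qed.

Lemma filter1_sub I : ideal I -> (forall a, a \in m -> I (iota a)) ->
  max_completion `<=` I.
Proof.
move=> iI mI u; have [s ms] := noethR (ideal_max m).
move/(filter1_gen ms) => [d ->]; apply: (@submod_sum C C^o) => // i.
apply: mI; have : spanl [set 0] s s`_i.
  by apply: mem_spanl; [exact: submod_set0|exact: mem_nth].
by rewrite -ms.
Qed.

(* The power series version of Hilbert's basis theorem: the ideals [L n] of
   leading coefficients, with respect to the powers of [a], of the elements of
   [J] form a stationary chain of finitely generated ideals. *)
Lemma fg_step I (a : C) : ideal I -> max_completion a ->
  (forall J, ideal J -> @adds C C^o I a `<=` J -> fg_ideal J) ->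
  forall J, ideal J -> I `<=` J -> fg_ideal J.
Proof.
move=> iI Fa Ifg J iJ IJ.
pose L n : set C := [set c | exists g, J (a ^+ n * c + a ^+ n.+1 * g)].
have iL n : ideal (L n).
  split=> [|c c' [g Jg] [g' Jg']|b c [g Jg]].
  - by exists 0; rewrite !mulr0 addr0; apply: idl0.
  - exists (g + g'); rewrite (_ : _ + _ = (a ^+ n * c + a ^+ n.+1 * g) +
      (a ^+ n * c' + a ^+ n.+1 * g')); last by ring.
    exact: idlD.
  - exists (b * g); rewrite (_ : _ + _ = b * (a ^+ n * c + a ^+ n.+1 * g)).
      exact: idl_mull.
    by rewrite [b *: c]/GRing.scale /=; ring.
have LS n : L n `<=` L n.+1.
  move=> c [g Jg]; exists g.
  rewrite (_ : _ + _ = a * (a ^+ n * c + a ^+ n.+1 * g)); last by rewrite !exprS; ring.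
  exact: idl_mull.
have IL n : @adds C C^o I a `<=` L n.
  apply: (@adds_sub C C^o) => // [c Ic|].
    by exists 0; rewrite mulr0 addr0; apply: idl_mull => //; apply: IJ.
  (* [a] is a leading coefficient because [a^n a - a^(n+1) = 0] lies in [J]. *)
  by exists (-1); rewrite mulrN1 -exprSr subrr; apply: idl0.
have [s es] : fg_ideal (\bigcup_n L n).
  apply: Ifg; first exact: (@submod_bigcup C C^o).
  by move=> c Ic; exists 0%N => //; apply: IL.
have [n0 Ln0] := @chain_stable C C^o L s iL LS es.
(* The [f i] are elements of [J] whose leading coefficients generate [L n]. *)
have lift n : exists k (f : 'I_k -> C), (forall i, J (f i)) /\ forall c, L n c ->
    exists (d : 'I_k -> C) g, a ^+ n * c - \sum_i d i * f i = a ^+ n.+1 * g.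
  have [t et] := Ifg _ (iL n) (@IL n).
  have /choice[g gP] (i : 'I_(size t)) : exists g, J (a ^+ n * t`_i + a ^+ n.+1 * g).
    have : L n t`_i by rewrite et; apply: mem_spanl; [exact: submod_set0|exact: mem_nth].
    by [].
  exists (size t), (fun i : 'I_(size t) => a ^+ n * t`_i + a ^+ n.+1 * g i); split=> // c.
  rewrite et => /(spanl_sum (@submod_set0 _ C^o))[d /eqP]; rewrite subr_eq0 => /eqP ->.
  exists (fun i : 'I__ => d i), (- \sum_(i < size t) d i * g i).
  rewrite mulrN !mulr_sumr -sumrB -sumrN; apply: eq_bigr => i _.
  by rewrite [_ *: _]/GRing.scale /=; ring.
(* Induction on [j] captures the multiples of [a^(n0 - j)] in [J]; at [j = n0] these are all of
   [J]. *)
have fgL j : exists t : seq C^o, (forall v, v \in t -> J v) /\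
    forall c, J (a ^+ (n0 - j) * c) -> spanl [set 0] t (a ^+ (n0 - j) * c).
  elim: j => [|j [t [tJ tP]]].
    have [k [f [Jf fP]]] := lift n0; exists (codom f).
    split=> [_ /codomP[i ->]|c]; first exact: Jf.
    rewrite subn0 => Jc.
    (* Since [L] is stationary from [n0] on, the same [f i], multiplied by [a^n], reduce the
       multiples of [a^(n0 + n)] in [J]. *)
    pose H n : set C := [set u | J u /\ exists c, u = a ^+ (n0 + n) * c].
    have HF n : H n `<=` adic_filter n.
      move=> _ [_ [b ->]]; rewrite addnC exprD -mulrA.
      exact: (idl_mulr _ (@ideal_filter _ _ n) (filterX n Fa)).
    have Hstep n u : H n u -> exists d : 'I_k -> C,
        (forall i, adic_filter n (d i)) /\ H n.+1 (u - \sum_i d i * f i).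
      move=> [Ju [b eu]].
      have [|d [g dg]] := fP b.
        by apply: (Ln0 (n0 + n)%N); exists 0; rewrite mulr0 addr0 -eu.
      exists (fun i => a ^+ n * d i); split=> [i|].
        exact: (idl_mulr _ (@ideal_filter _ _ n) (filterX n Fa)).
      split.
        by apply: idlB => //; apply: (@submod_sum C C^o).
      exists g; rewrite addnS addnC -addnS exprD -mulrA -dg eu exprD mulrBr mulr_sumr.
      by congr (_ - _); [ring|apply: eq_bigr => i _; rewrite mulrA].
    have [|d ->] := filter_gen HF Hstep (u := a ^+ n0 * c).
      by split=> //; exists c; rewrite addn0.
    apply: (@submod_sum C C^o); first exact/submod_spanl/submod_set0.
    by move=> i; apply: mem_spanl; [exact: submod_set0|exact: codom_f].
  have [le|lt] := leqP n0 j.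
    move: (tP); rewrite (eqP le) (_ : n0 - j.+1 = 0)%N //; first by exists t.
    by apply/eqP; rewrite subn_eq0 ltnW.
  have [k [f [Jf fP]]] := lift (n0 - j.+1)%N.
  exists (t ++ codom f); split=> [v|c Jc].
    by rewrite mem_cat => /orP[/tJ//|/codomP[i ->]]; exact: Jf.
  have [|d [g dg]] := fP c; first by exists 0; rewrite mulr0 addr0.
  have s0 := @submod_set0 _ C^o.
  have sub1 : {subset t <= t ++ codom f} by move=> v vt; rewrite mem_cat vt.
  have Jg : J (a ^+ (n0 - j) * g).
    rewrite -subSn // subSS in dg *; rewrite -dg; apply: idlB => //.
    exact: (@submod_sum C C^o).
  have := spanl_mono s0 sub1 (tP g Jg).
  rewrite -[in a ^+ (n0 - j)]subSS subSn // -dg => sg.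
  apply: (@submodBK C C^o _ _ _ (submod_spanl _ s0) sg).
  apply: (@submod_sum C C^o); first exact/submod_spanl/submod_set0.
  by move=> i; apply: mem_spanl => //; rewrite mem_cat codom_f orbT.
have [t [tJ tP]] := fgL n0; exists t; apply/seteqP; split=> c.
  by have := tP c; rewrite subnn mul1r.
by apply: (@spanl_sub C C^o) => // _ ->; apply: idl0.
Qed.

Lemma fg_spanl (s : seq C^o) I : ideal I -> (forall v, v \in s -> max_completion v) ->
  (forall J, ideal J -> @spanl C C^o I s `<=` J -> fg_ideal J) ->
  forall J, ideal J -> I `<=` J -> fg_ideal J.
Proof.
move=> iI; elim: s => [|v s IH] //= sF sfg; apply: IH.
  by move=> w ws; apply: sF; rewrite inE ws orbT.
apply: fg_step sfg; first exact: submod_spanl.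
by apply: sF; apply: mem_head.
Qed.

(** The only ideals over the extension of [m] are that extension and the whole ring; the generators
    of [m] are then removed one at a time by [fg_step], down to the zero ideal. *)
Lemma noeth_completion : noeth C.
Proof.
have [s ms] := noethR (ideal_max m).
have sm a : a \in s -> a \in m.
  by move/(mem_spanl (@submod_set0 _ R^o)); rewrite -ms.
have tF v : v \in map iota s -> max_completion v.
  move=> /mapP[a /sm ma ->]; apply: filter_iota => /=.
  by apply: mem_submod_span; exists a => //; exists 1; rewrite ?mulr1.
move=> J iJ; apply: (fg_spanl (s := map iota s) (@submod_set0 _ C^o) tF _ iJ); last first.
  by move=> _ ->; exact: idl0 iJ.
move=> {iJ}J iJ sJ.
have s0 := @submod_spanl C C^o _ (map iota s) (@submod_set0 _ C^o).
have Fs : max_completion `<=` @spanl C C^o [set 0] (map iota s).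
  apply: filter1_sub => // a am.
  have /(spanl_sum (@submod_set0 _ R^o))[d /eqP] : spanl [set 0] s a by rewrite -ms.
  rewrite subr_eq0 => /eqP ->; rewrite rmorph_sum.
  under eq_bigr do rewrite [_ *: _]/GRing.scale /= rmorphM.
  apply: (@submod_sum C C^o) => // i.
  apply: mem_spanl; first exact: submod_set0.
  by apply/map_f/mem_nth.
have [J1|J1] := pselect (J 1).
  exists [:: (1 : C)]; apply/seteqP; split=> u _; last exact: ideal_full.
  by exists u => /=; rewrite [_ *: _]mulr1 subrr.
exists (map iota s); apply/seteqP; split=> // u Ju.
exact/Fs/(proper_sub_filter1 iJ J1).
Qed.

End CompletionLocalNoetherian.

(** * Fibres over the spectrum *)

Section Fibers.
Variables (R : comNzRingType) (m : idealr R).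
Hypotheses (noethR : noeth R) (localR : local_ring m).
Local Notation C := (completion m).
Local Notation iota := (@to_completion R m).
Implicit Types (p q : set R) (P Q : set C).

Definition contraction P : set R := [set a | P (iota a)].

Lemma contraction_prime P : primeI P -> primeI (contraction P).
Proof.
move=> [iP P1 PM]; rewrite /contraction; split=> /=.
- split=> [|a b Pa Pb|a b Pb] /=; first by rewrite rmorph0; apply: idl0.
    by rewrite rmorphD; apply: idlD.
  by rewrite [_ *: _]/GRing.scale /= rmorphM; apply: idl_mull.
- by rewrite rmorph1.
- by move=> a b; rewrite rmorphM => /PM.
Qed.

Lemma finite_fiber p : primeI p -> finite_set [set q | primeI q /\ p `<=` q] ->
  finite_set [set P | primeI P /\ contraction P = p].
Proof.
move=> pp finp.
have pm : p `<=` [set a | a \in m].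
  by apply: (proper_sub_max noethR localR); [exact: primeI_ideal|exact: primeI_neq1].
have max_sub P : primeI P -> P `<=` adic_filter 1.
  by move=> [iP P1 _]; apply: (proper_sub_filter1 noethR localR).
have sub_max P : primeI P -> [set a | a \in m] `<=` contraction P -> adic_filter 1 `<=` P.
  by move=> pP mP; apply: (filter1_sub noethR) => //; apply: primeI_ideal.
have [mp|mp] := pselect ([set a | a \in m] `<=` p).
  apply: (@sub_finite_set _ _ [set (adic_filter 1 : set C)]); last exact: finite_set1.
  move=> P [pP eP] /=; apply/seteqP; split; first exact: max_sub.
  by apply: sub_max => //; rewrite eP.
have /finite_seqP[s es] := finp.
have sP q : q \in s <-> primeI q /\ p `<=` q.
  by have := congr1 (fun S : set (set R) => S q) es; rewrite /= => ->.
(* [y] lies in [m] but in no prime over [p] other than [m]. *)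
have [|y my ys] := @prime_avoidance R _ s [set q | ~ [set a | a \in m] `<=` q] (ideal_max m).
  by move=> q /sP[pq _] nq; split.
have yp : ~ p y by apply: (ys p _ mp); apply/sP; split.
have noethC := noeth_completion noethR localR.
pose E := submod_span (V := C^o) (iota @` p).
have iE : ideal [set u | u \in E] := submod_of_closed E.
have [F [finF Fp FQ]] := minimal_primes noethC iE.
apply: sub_finite_set finF => Q [pQ eQ].
have [|P FP PQ] := FQ Q pQ.
  move=> u; apply: (submod_span_min (primeI_ideal pQ)) => _ [a pa <-].
  by rewrite -eQ in pa.
suff QP : Q `<=` P by rewrite (_ : Q = P) //; apply/seteqP.
have [pP EP] := Fp P FP.
have my1 : adic_filter 1 (iota y).
  by apply: filter_iota; apply: mem_submod_span; exists y => //; exists 1; rewrite ?mulr1.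
apply: (krull_principal noethC (local_at_completion noethR localR)
  (@max_completion_neq1 _ _) pP pQ PQ (max_sub Q pQ) my1).
  by move=> Qy; apply: yp; rewrite -eQ.
(* [T] contracts to a prime over [p] containing [y], which can only be [m]; this is the minimality
   that Krull's theorem requires. *)
move=> T pT PT Ty; apply: sub_max => //; apply: contrapT => mT.
apply: (ys (contraction T)) => //; apply/sP; split; first exact: contraction_prime.
by move=> a pa; apply/PT/EP/mem_submod_span; exists a.
Qed.

End Fibers.

(** * Finiteness of associated primes after base change to the completion *)

Theorem theorem0p3 (R : comNzRingType) (m : idealr R) (M : lmodType R)
    (R_noetherian : noetherian R) (R_local : local_ring m)
    (M_wl : weakly_laskerian M) :
  weakly_laskerian (scalar_ext M (completion m)).
Proof.
have noethR := noetherian_noeth R_noetherian.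
have noethC := noeth_completion noethR R_local.
have [s fins] := finite_ass_support noethR ((weakly_laskerianE M).1 M_wl).
set C := completion m; set iota := @to_completion R m; set V := scalar_ext M C.
pose L := spanl [set 0] s.
apply/weakly_laskerianE => K sK _.
pose sV : seq V := [seq tens x (1 : C) | x <- s].
(* [K1] is the sum of [K] and the image of [L] tensored with [C], so [V/K1] is a quotient of [M/L]
   tensored with [C]. *)
pose K1 := spanl K sV.
have sK1 : submod K1 := submod_spanl sV sK.
have tensK1 x (u : C) : L x -> K1 (tens x u).
  have Ksub t : {subset t <= s} -> forall x, spanl [set 0] t x -> K1 (tens x u).
    elim: t => [|y t IH] ts x' /=.
      move=> ->; rewrite -(scale0r (0 : M)) tensZl scale0r; exact: (submod0 sK1).
    move=> [a ta]; rewrite -(subrK (a *: y) x') tensDl.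
    apply: (submodD sK1); first by apply: IH ta => z zt; apply: ts; rewrite inE zt orbT.
    rewrite tensZl -tensZr.
    rewrite (_ : tens y (a *: u) = (a *: u : C) *: (tens y (1 : C) : V)); last first.
      by rewrite [RHS]scalar_ext_scaleE mulr1.
    apply: (submodZ _ sK1); apply: (mem_spanl sK); apply: map_f; apply: ts.
    exact: mem_head.
  exact: Ksub.
have suppK1 (w : V) P : primeI P -> colon K1 w `<=` P ->
    supp L (contraction P).
  move=> pP wP; split; first exact: contraction_prime.
  have iP := primeI_ideal pP.
  (* If [P] contains the annihilator of a sum, it contains that of one of the terms, which reduces
     [w] to a pure tensor. *)
  elim/tensor_ind: w wP => [|t u IHt IHu|x u] wP.
  - case: (primeI_neq1 pP); apply: wP; rewrite /colon /=.
    by rewrite scaler0; apply: (submod0 sK1).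
  - have [/IHt//|/existsNP[a /not_implyP[ta Pa]]] := pselect (colon K1 (t : V) `<=` P).
    apply: IHu => b ub; have : P (a * b).
      apply: wP; rewrite /colon /= scalerDr; apply: (submodD sK1).
        by rewrite mulrC -scalerA; apply: (submodZ _ sK1).
      by rewrite -scalerA; apply: (submodZ _ sK1).
    by move=> /(primeIM pP)[].
  - exists x => r Lr; apply: wP; rewrite /colon /=.
    rewrite [_ *: _]scalar_ext_scaleE (_ : _ * u = r *: u) // tensZr -tensZl.
    exact: tensK1.
apply: (@sub_finite_set _ _ (ass_in K K1 `|`
  \bigcup_(p in supp L) [set P | primeI P /\ contraction P = p])).
  move=> P [pP [w _ eP]].
  have [eP1|[v Kv ev]] := ass_split sK sK1 (@sub_spanl _ _ K sV) pP eP.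
    by right; exists (contraction P) => //; apply: (suppK1 w) => //; rewrite eP1.
  by left; split=> //; exists v.
rewrite finite_setU; split; first exact: ass_spanl.
(* All primes over a [p] in the support of [M/L] lie there too, so [p] has only finitely many
   overprimes. *)
apply: bigcup_finite => // p sp; apply: finite_fiber => //; first by case: sp.
by apply: sub_finite_set fins => q [pq pq']; apply: supp_specialize sp _ _.
Qed.
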